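(* Let $R$ be a commutative Noetherian local ring. The following are equivalent: (1) $R$ is Cohen-Macaulay. (2) There exists a non-zero Cohen-Macaulay finitely generated $R$-module $M$ with $\operatorname{qpd}_R M<\infty$ and $\dim M=\dim R-\operatorname{grade} M$. (3) There exists a non-zero Cohen-Macaulay finitely generated $R$-module $M$ with $\operatorname{qpd}_R M<\infty$ and such that $\dim R/\mathfrak{p}+\operatorname{depth} R_{\mathfrak{p}}=\dim R$ for some $\mathfrak{p}\in\operatorname{Ass} M$.
   Context: $\operatorname{grade} M:=\inf\{i\ge 0:\operatorname{Ext}^i_R(M,R)\ne 0\}$, and $\dim$ denotes Krull dimension. For a complex $X$ of $R$-modules (homologically indexed), $\sup X=\sup\{i: X_i\ne 0\}$, $\inf X=\inf\{i: X_i\neq 0\}$, $\operatorname{hsup}X=\sup\{i: H_i(X)\neq 0\}$. $X$ is bounded below if $\inf X>-\infty$, and bounded if $\sup X-\inf X<\infty$. A quasi-projective resolution of $M$ is a bounded below complex $P$ of (finitely generated) projective $R$-modules such that for all $i\ge\inf P$ there exist non-negative integers $a_i$, not all zero, with $H_i(P)\cong M^{\oplus a_i}$. The quasi-projective dimension of $M\neq 0$ is $\operatorname{qpd}_R M=\inf\{\sup P-\operatorname{hsup}P : P \text{ is a bounded quasi-projective resolution of } M\}$; it is $\infty$ if $M$ has no bounded quasi-projective resolution. *)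

(* Defs.v *)
From HB Require Import structures.
From mathcomp Require Import all_boot all_order all_algebra.
From mathcomp Require Import generic_quotient ring_quotient.
From mathcomp Require Import ring.
From mathcomp Require Import boolp classical_sets functions.
From mathcomp Require Import constructive_ereal.

Set Implicit Arguments.
Unset Strict Implicit.
Unset Printing Implicit Defensive.

Import Order.TTheory GRing.Theory Num.Theory.
Local Open Scope classical_set_scope.
Local Open Scope quotient_scope.
Local Open Scope ring_scope.

Definition nonzero_mod (R : pzRingType) (M : lmodType R) : Prop :=
  exists x : M, x != 0.

Definition isomorphic (R : pzRingType) (M N : lmodType R) : Prop :=
  exists f : {linear M -> N}, bijective f.

Definition finitely_generated (R : pzRingType) (M : lmodType R) : Prop :=
  exists (n : nat) (g : 'I_n -> M),
    forall x, exists c : 'I_n -> R, x = \sum_i c i *: g i.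

Definition projective (R : pzRingType) (P : lmodType R) : Prop :=
  forall (A B : lmodType R) (g : {linear A -> B}) (f : {linear P -> B}),
    (forall b, exists a, g a = b) ->
    exists h : {linear P -> A}, forall x, g (h x) = f x.

(* Quotients of modules: the additive quotient group is the library's one. *)
Section QuotientModule.
Variables (R : pzRingType) (M : lmodType R) (S : submodClosed M).

Let mem_S : {pred M} := S.

Lemma submod_zmod_closed : zmod_closed mem_S.
Proof.
by split=> [|x y xS yS]; rewrite ?rpred0 // -scaleN1r rpredD // rpredZ.
Qed.

Definition submod_zmod : zmodClosed M :=
  HB.pack_for (zmodClosed M) mem_S
    (GRing.isZmodClosed.Build M mem_S submod_zmod_closed).

Definition quot_mod : Type := {ideal_quot submod_zmod}.

HB.instance Definition _ := GRing.Zmodule.on quot_mod.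

Definition quot_pi (x : M) : quot_mod := \pi_{ideal_quot submod_zmod} x.
Definition quot_repr (x : quot_mod) : M := repr (x : {ideal_quot submod_zmod}).

Lemma quot_reprK : cancel quot_repr quot_pi.
Proof. by move=> x; rewrite /quot_pi /quot_repr reprK. Qed.

Lemma quot_piP (x y : M) : quot_pi x = quot_pi y <-> x - y \in S.
Proof.
have -> : (x - y \in S) = (x - y \in submod_zmod) by [].
by rewrite Quotient.idealrBE; split=> /eqP.
Qed.

Lemma quot_piD (x y : M) : quot_pi (x + y) = quot_pi x + quot_pi y.
Proof. exact: Quotient.pi_add. Qed.

Definition quot_scale (a : R) (x : quot_mod) : quot_mod :=
  quot_pi (a *: quot_repr x).

Lemma quot_pi_scale a x : quot_pi (a *: x) = quot_scale a (quot_pi x).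
Proof.
apply/quot_piP; rewrite -scalerBr rpredZ //.
by apply/quot_piP; rewrite quot_reprK.
Qed.

Lemma quot_scaleA a b x :
  quot_scale a (quot_scale b x) = quot_scale (a * b) x.
Proof. by rewrite -(quot_reprK x) -!quot_pi_scale scalerA. Qed.

Lemma quot_scale1 : left_id 1 quot_scale.
Proof. by move=> x; rewrite -(quot_reprK x) -!quot_pi_scale scale1r. Qed.

Lemma quot_scaleDr : right_distributive quot_scale +%R.
Proof.
move=> a x y; rewrite -(quot_reprK x) -(quot_reprK y).
by rewrite -quot_piD -!quot_pi_scale scalerDr quot_piD.
Qed.

Lemma quot_scaleDl x : {morph quot_scale^~ x : a b / a + b}.
Proof.
by move=> a b; rewrite -(quot_reprK x) -!quot_pi_scale scalerDl quot_piD.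
Qed.

HB.instance Definition _ := GRing.Zmodule_isLmodule.Build R quot_mod
  quot_scaleA quot_scale1 quot_scaleDr quot_scaleDl.

End QuotientModule.

Section Homology.
Variables (R : pzRingType) (U V W : lmodType R).
Variables (f : {linear U -> V}) (g : {linear V -> W}).

Definition ker_pred : {pred V} := fun x => g x == 0.

Lemma ker_pred_closed : subsemimod_closed ker_pred.
Proof.
split; first split.
- by rewrite unfold_in linear0.
- by move=> x y; rewrite !unfold_in linearD => /eqP -> /eqP ->; rewrite addr0.
- by move=> a x; rewrite !unfold_in linearZ => /eqP -> /=; rewrite scaler0.
Qed.

HB.instance Definition _ :=
  GRing.isSubmodClosed.Build R V ker_pred ker_pred_closed.

Definition kernel : Type := {x : V | x \in ker_pred}.
HB.instance Definition _ := SubChoice.on kernel.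
HB.instance Definition _ := [SubChoice_isSubLmodule of kernel by <:].

(* Elements of [ker g] lying in the image of [f]. *)
Definition boundary_pred : {pred kernel} :=
  fun z => `[< exists x, f x = val z >].

Lemma boundary_pred_closed : subsemimod_closed boundary_pred.
Proof.
split; first split.
- by rewrite unfold_in; apply/asboolP; exists 0; rewrite linear0 raddf0.
- move=> x y; rewrite !unfold_in => /asboolP[u fu] /asboolP[v fv].
  by apply/asboolP; exists (u + v); rewrite linearD fu fv raddfD.
- move=> a x; rewrite !unfold_in => /asboolP[u fu].
  by apply/asboolP; exists (a *: u); rewrite linearZ fu linearZ.
Qed.

HB.instance Definition _ :=
  GRing.isSubmodClosed.Build R kernel boundary_pred boundary_pred_closed.

Definition ker_mod_im : lmodType R := quot_mod boundary_pred.

End Homology.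

(* Homologically indexed complexes; as there is a map between any two terms,
   the only meaningful differentials are the [cdiff i j] with [i = j + 1]. *)
Record complex (R : pzRingType) := Complex {
  cobj :> int -> lmodType R;
  cdiff : forall i j, {linear cobj i -> cobj j};
  cdiff_shape : forall i j, i <> j + 1 -> forall x, cdiff i j x = 0;
  cdiff_sq0 : forall i j k x, cdiff j k (cdiff i j x) = 0 }.

Section Complexes.
Variable R : pzRingType.
Implicit Types X P : complex R.

Definition homology X (i : int) : lmodType R :=
  ker_mod_im (cdiff X (i + 1) i) (cdiff X i (i - 1)).

Definition csup X : \bar int :=
  supremum -oo%E [set i%:E | i in [set i : int | nonzero_mod (X i)]].

Definition cinf X : \bar int :=
  infimum +oo%E [set i%:E | i in [set i : int | nonzero_mod (X i)]].

Definition hsup X : \bar int :=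
  supremum -oo%E [set i%:E | i in [set i : int | nonzero_mod (homology X i)]].

Definition bounded_below X : Prop := (-oo < cinf X)%E.

Definition bounded X : Prop := (csup X - cinf X < +oo)%E.

Definition quasi_projective_resolution P (M : lmodType R) : Prop :=
  [/\ bounded_below P,
      forall i, finitely_generated (P i) /\ projective (P i) &
      exists a : int -> nat,
        (forall i : int, (cinf P <= i%:E)%E ->
           isomorphic (homology P i) {ffun 'I_(a i) -> M}) /\
        (exists2 i : int, (cinf P <= i%:E)%E & a i <> 0%N)].

(* Only meant for [M <> 0]. *)
Definition qpd (M : lmodType R) : \bar int :=
  infimum +oo%E [set d | exists P : complex R,
    [/\ quasi_projective_resolution P M, bounded P & d = (csup P - hsup P)%E]].

Definition projective_resolution P (M : lmodType R) : Prop :=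
  [/\ forall i, projective (P i),
      forall i, i < 0 -> ~ nonzero_mod (P i),
      forall i, 0 < i -> ~ nonzero_mod (homology P i) &
      isomorphic (homology P 0) M].

End Complexes.

Section DefaultComplex.
Variables (R : pzRingType) (M : lmodType R).

Definition default_complex : complex R :=
  @Complex R (fun=> M) (fun _ _ => \0 : {linear M -> M})
    (fun _ _ _ _ => erefl) (fun _ _ _ _ => erefl).

(* A chosen projective resolution of [M]; [default_complex] is a dummy value,
   since projective resolutions always exist. *)
Definition proj_res : complex R :=
  if pselect (exists P, projective_resolution P M) is left P
  then sval (cid P) else default_complex.

End DefaultComplex.

Section Hom.
Variables (R : comPzRingType) (U V : lmodType R).

Definition linear_pred : {pred U -> V} := fun f => `[< linear f >].

Lemma linear_pred_closed : subsemimod_closed linear_pred.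
Proof.
split; first split.
- by apply/asboolP => a x y; rewrite [LHS]/= scaler0 addr0.
- move=> f g /asboolP lf /asboolP lg; apply/asboolP => a x y.
  have E u : (f + g) u = f u + g u by [].
  by rewrite !E lf lg scalerDr addrACA.
- move=> b f /asboolP lf; apply/asboolP => a x y.
  have E u : (b *: f) u = b *: f u by [].
  by rewrite !E lf scalerDr !scalerA mulrC.
Qed.

HB.instance Definition _ :=
  GRing.isSubmodClosed.Build R (U -> V) linear_pred linear_pred_closed.

Definition hom_mod : Type := {f : U -> V | f \in linear_pred}.
HB.instance Definition _ := SubChoice.on hom_mod.
HB.instance Definition _ := [SubChoice_isSubLmodule of hom_mod by <:].

Lemma hom_mod_linear (f : hom_mod) : linear (val f).
Proof. by case: f => f /= /asboolP. Qed.

End Hom.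

Section HomComplex.
Variables (R : comPzRingType).

Section Precomposition.
Variables (A B N : lmodType R) (d : {linear A -> B}).

Lemma precomp_subproof (f : hom_mod B N) : val f \o d \in @linear_pred R A N.
Proof.
by apply/asboolP => a x y; rewrite /= linearP hom_mod_linear.
Qed.

Definition precomp (f : hom_mod B N) : hom_mod A N :=
  exist _ (val f \o d) (precomp_subproof f).

Lemma precomp_linear : linear precomp.
Proof. by move=> a f g; apply: val_inj; apply/funext => x. Qed.

HB.instance Definition _ :=
  GRing.isLinear.Build R (hom_mod B N) (hom_mod A N) *:%R precomp precomp_linear.

End Precomposition.

Variables (P : complex R) (N : lmodType R).

(* The degree [j] term of Hom(P, N) is Hom(P_(-j), N). *)
Definition hom_complex_obj (j : int) : lmodType R := hom_mod (P (- j)) N.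

Definition hom_complex_diff (i j : int) :
    {linear hom_complex_obj i -> hom_complex_obj j} :=
  @precomp (P (- j)) (P (- i)) N (cdiff P (- j) (- i)).

Lemma hom_complex_shape i j :
  i <> j + 1 -> forall f, hom_complex_diff i j f = 0.
Proof.
move=> ij f; apply: val_inj; apply/funext => x /=.
rewrite cdiff_shape => [|/eqP ij'].
  by have := hom_mod_linear f (-1) 0 0; rewrite scaler0 addr0 scaleN1r addNr.
apply: ij; apply/eqP.
by rewrite -subr_eq -eqr_opp opprB addrC eq_sym.
Qed.

Lemma hom_complex_sq0 i j k f :
  hom_complex_diff j k (hom_complex_diff i j f) = 0.
Proof.
apply: val_inj; apply/funext => x /=.
rewrite cdiff_sq0.
by have := hom_mod_linear f (-1) 0 0; rewrite scaler0 addr0 scaleN1r addNr.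
Qed.

Definition hom_complex : complex R :=
  Complex hom_complex_shape hom_complex_sq0.

End HomComplex.

Definition Ext (R : comPzRingType) (n : nat) (M N : lmodType R) : lmodType R :=
  homology (hom_complex (proj_res M) N) (- n%:Z).

Definition grade (R : comNzRingType) (M : lmodType R) : \bar int :=
  infimum +oo%E [set n%:Z%:E | n in [set n : nat | nonzero_mod (Ext n M R^o)]].

(* The length of a chain is the number of strict inclusions. *)
Definition krull_dim (A : comNzRingType) : \bar int :=
  supremum -oo%E [set n%:Z%:E | n in [set n : nat |
    exists p : 'I_n.+1 -> prime_idealr A, forall i j : 'I_n.+1, (i < j)%N ->
      {subset p i <= p j} /\ ~ {subset p j <= p i}]].

Section ModuleInvariants.
Variables (R : comNzRingType) (M : lmodType R).

Definition ann_pred : {pred R} := fun a => `[< forall x : M, a *: x = 0 >].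

Lemma ann_pred_idealr : nonzero_mod M -> idealr_closed ann_pred.
Proof.
case=> x x0; split.
- by apply/asboolP => y; rewrite scale0r.
- by apply/negP => /asboolP /(_ x); rewrite scale1r => /eqP; apply/negP.
- move=> a b c /asboolP b0 /asboolP c0.
  by apply/asboolP => y; rewrite scalerDl -scalerA b0 c0 scaler0 addr0.
Qed.

Definition annihilator (M0 : nonzero_mod M) : idealr R :=
  HB.pack_for (idealr R) ann_pred (isIdealr.Build R ann_pred (ann_pred_idealr M0)).

(* [dim M] is the Krull dimension of [R / Ann M], and -oo for [M = 0]. *)
Definition dim_mod : \bar int :=
  if pselect (nonzero_mod M) is left M0
  then krull_dim {ideal_quot (annihilator M0)} else -oo%E.

Definition associated_prime (p : prime_idealr R) : Prop :=
  exists x : M, forall a, a \in p <-> a *: x = 0.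

(* The submodule generated by the [s`_i *: x]. *)
Definition seq_mul_pred (s : seq R) : {pred M} :=
  fun x => `[< exists c : nat -> M, x = \sum_(i < size s) s`_i *: c i >].

Lemma seq_mul_pred_closed s : subsemimod_closed (seq_mul_pred s).
Proof.
split; first split.
- rewrite unfold_in; apply/asboolP; exists (fun=> 0).
  by rewrite big1 // => i _; rewrite scaler0.
- move=> x y; rewrite !unfold_in => /asboolP[c ->] /asboolP[d ->].
  apply/asboolP; exists (fun i => c i + d i).
  by rewrite -big_split; apply: eq_bigr => i _; rewrite scalerDr.
- move=> a x; rewrite !unfold_in => /asboolP[c ->].
  apply/asboolP; exists (fun i => a *: c i).
  by rewrite scaler_sumr; apply: eq_bigr => i _; rewrite !scalerA mulrC.
Qed.

HB.instance Definition _ (s : seq R) :=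
  GRing.isSubmodClosed.Build R M (seq_mul_pred s) (seq_mul_pred_closed s).

Definition regular_sequence (s : seq R) : Prop :=
  (forall i, (i < size s)%N ->
     forall x : quot_mod (seq_mul_pred (take i s)), s`_i *: x = 0 -> x = 0) /\
  nonzero_mod (quot_mod (seq_mul_pred s)).

End ModuleInvariants.

Definition maximal_ideal (R : comNzRingType) (m : idealr R) : Prop :=
  forall I : idealr R, {subset m <= I} -> {subset I <= m}.

Definition local (R : comNzRingType) : Prop :=
  exists2 m : idealr R, maximal_ideal m &
    forall m' : idealr R, maximal_ideal m' -> m' =i m.

(* An [idealr] is a proper ideal; the unit ideal is always generated by 1. *)
Definition noetherian (R : comNzRingType) : Prop :=
  forall I : idealr R, exists (n : nat) (g : 'I_n -> R),
    forall x, x \in I <-> exists c : 'I_n -> R, x = \sum_i c i * g i.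

(* Membership in a maximal ideal, hence in the maximal ideal if [R] is local. *)
Definition in_max_ideal (R : comNzRingType) (x : R) : Prop :=
  exists2 m : idealr R, maximal_ideal m & x \in m.

(* Only meant for local [R]. *)
Definition depth (R : comNzRingType) (M : lmodType R) : \bar int :=
  supremum -oo%E [set (size s)%:Z%:E | s in [set s : seq R |
    (forall x, x \in s -> in_max_ideal x) /\ regular_sequence M s]].

Definition depth_ring (R : comNzRingType) : \bar int := depth R^o.

Definition cohen_macaulay_mod (R : comNzRingType) (M : lmodType R) : Prop :=
  depth M = dim_mod M.

Definition cohen_macaulay (R : comNzRingType) : Prop :=
  cohen_macaulay_mod R^o.

(* Localization at a prime ideal: the library only has fields of fractions. *)
Module Localization.
Section Localization.
Variables (R : comNzRingType) (p : prime_idealr R).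

Definition denom : Type := {s : R | s \notin p}.
HB.instance Definition _ := SubChoice.on denom.

Lemma one_subproof : 1 \notin p.
Proof. by rewrite idealr1. Qed.

Lemma mul_subproof (s t : denom) : val s * val t \notin p.
Proof. by rewrite prime_idealrM negb_or (valP s) (valP t). Qed.

Definition one_denom : denom := exist (fun s => s \notin p) 1 one_subproof.
Definition mul_denom (s t : denom) : denom :=
  exist (fun s => s \notin p) _ (mul_subproof s t).

Definition frac : Type := (R * denom)%type.
HB.instance Definition _ := Choice.on frac.

Definition equiv (x y : frac) : bool :=
  `[< exists u : denom, val u * (x.1 * val y.2 - y.1 * val x.2) = 0 >].

Lemma equiv_refl : reflexive equiv.
Proof. by move=> x; apply/asboolP; exists one_denom; rewrite subrr mulr0. Qed.

Lemma equiv_sym : symmetric equiv.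
Proof.
move=> x y; apply/asboolP/asboolP => -[u u0]; exists u;
by rewrite -opprB mulrN u0 oppr0.
Qed.

Lemma equiv_trans : transitive equiv.
Proof.
move=> y x z /asboolP[u u0] /asboolP[v v0]; apply/asboolP.
exists (mul_denom (mul_denom u v) y.2) => /=.
transitivity (val v * val z.2 * (val u * (x.1 * val y.2 - y.1 * val x.2))
  + val u * val x.2 * (val v * (y.1 * val z.2 - z.1 * val y.2))).
  by rewrite /=; ring.
by rewrite u0 v0 !mulr0 addr0.
Qed.

Canonical equiv_equiv := EquivRel equiv equiv_refl equiv_sym equiv_trans.

Definition type : Type := {eq_quot equiv}.
HB.instance Definition _ : EqQuotient _ equiv type := EqQuotient.on type.
HB.instance Definition _ := Choice.on type.

(* The class of the fraction [x.1 / x.2]. *)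
Definition cls (x : frac) : type := \pi_type x.

Lemma clsP x y : cls x = cls y <->
  exists u : denom, val u * (x.1 * val y.2 - y.1 * val x.2) = 0.
Proof.
split=> [/eqmodP /asboolP //|xy].
by apply/eqmodP; apply/asboolP.
Qed.

Lemma cls_repr x : cls (repr x) = x.
Proof. exact: reprK. Qed.

Definition addf (x y : frac) : frac :=
  (x.1 * val y.2 + y.1 * val x.2, mul_denom x.2 y.2).
Definition oppf (x : frac) : frac := (- x.1, x.2).
Definition mulf (x y : frac) : frac := (x.1 * y.1, mul_denom x.2 y.2).

Definition add (x y : type) : type := cls (addf (repr x) (repr y)).
Definition opp (x : type) : type := cls (oppf (repr x)).
Definition mul (x y : type) : type := cls (mulf (repr x) (repr y)).
Definition zero : type := cls (0, one_denom).
Definition one : type := cls (1, one_denom).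

Lemma add_cls x y : add (cls x) (cls y) = cls (addf x y).
Proof.
have /clsP[u u0] := cls_repr (cls x); have /clsP[v v0] := cls_repr (cls y).
apply/clsP; exists (mul_denom u v); move: u0 v0.
set x' := repr _; set y' := repr _ => u0 v0 /=.
transitivity (val v * val y.2 * val y'.2 *
    (val u * (x'.1 * val x.2 - x.1 * val x'.2))
  + val u * val x.2 * val x'.2 *
    (val v * (y'.1 * val y.2 - y.1 * val y'.2))).
  by rewrite /=; ring.
by rewrite u0 v0 !mulr0 addr0.
Qed.

Lemma opp_cls x : opp (cls x) = cls (oppf x).
Proof.
have /clsP[u u0] := cls_repr (cls x); apply/clsP; exists u.
by rewrite /= !mulNr -opprD mulrN u0 oppr0.
Qed.

Lemma mul_cls x y : mul (cls x) (cls y) = cls (mulf x y).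
Proof.
have /clsP[u u0] := cls_repr (cls x); have /clsP[v v0] := cls_repr (cls y).
apply/clsP; exists (mul_denom u v); move: u0 v0.
set x' := repr _; set y' := repr _ => u0 v0 /=.
transitivity (val v * y'.1 * val y.2 *
    (val u * (x'.1 * val x.2 - x.1 * val x'.2))
  + val u * x.1 * val x'.2 *
    (val v * (y'.1 * val y.2 - y.1 * val y'.2))).
  by rewrite /=; ring.
by rewrite u0 v0 !mulr0 addr0.
Qed.

Lemma addA : associative add.
Proof.
move=> x y z; rewrite -(cls_repr x) -(cls_repr y) -(cls_repr z) !add_cls.
by apply/clsP; exists one_denom; rewrite /=; ring.
Qed.

Lemma addC : commutative add.
Proof.
move=> x y; rewrite -(cls_repr x) -(cls_repr y) !add_cls.
by apply/clsP; exists one_denom; rewrite /=; ring.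
Qed.

Lemma add0 : left_id zero add.
Proof.
move=> x; rewrite -(cls_repr x) add_cls.
by apply/clsP; exists one_denom; rewrite /=; ring.
Qed.

Lemma addN : left_inverse zero opp add.
Proof.
move=> x; rewrite -(cls_repr x) opp_cls add_cls.
by apply/clsP; exists one_denom; rewrite /=; ring.
Qed.

HB.instance Definition _ := GRing.isZmodule.Build type addA addC add0 addN.

Lemma mulA : associative mul.
Proof.
move=> x y z; rewrite -(cls_repr x) -(cls_repr y) -(cls_repr z) !mul_cls.
by apply/clsP; exists one_denom; rewrite /=; ring.
Qed.

Lemma mulC : commutative mul.
Proof.
move=> x y; rewrite -(cls_repr x) -(cls_repr y) !mul_cls.
by apply/clsP; exists one_denom; rewrite /=; ring.
Qed.

Lemma mul1 : left_id one mul.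
Proof.
move=> x; rewrite -(cls_repr x) mul_cls.
by apply/clsP; exists one_denom; rewrite /=; ring.
Qed.

Lemma mulDl : left_distributive mul add.
Proof.
move=> x y z; rewrite -(cls_repr x) -(cls_repr y) -(cls_repr z).
rewrite add_cls !mul_cls add_cls.
by apply/clsP; exists one_denom; rewrite /=; ring.
Qed.

Lemma one_neq0 : one != zero.
Proof.
apply/eqP => /clsP[u /=]; rewrite mul1r mul0r subr0 mulr1 => u0.
by have := valP u; rewrite /= u0 idealr0.
Qed.

HB.instance Definition _ :=
  GRing.Zmodule_isComNzRing.Build type mulA mulC mul1 mulDl one_neq0.

End Localization.
End Localization.
HB.export Localization.

Notation localization := Localization.type.

(* Main.v *)
(* Let P be a bounded quasi-projective resolution of M and s = hsup P. After dropping
   split injections at the top, P is minimal there; put sigma = sup P - s. The module M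
   embeds in the cokernel C of P_(s+1) -> P_s, and P truncated at s resolves C, with
   length sigma.
   - If Ext^i(M, R) = 0 for all i < g, dimension shifting gives Hom(M, C) = 0 as soon as
     g > sigma; hence grade M <= sigma. Likewise depth R_p <= sigma for p in Ass M.
   - depth M + sigma <= depth R: let t be the least degree in which the cohomology of
     the [delta]-cochains with values in R is nonzero. If t < depth M + sigma,
     the homologies of P do not interfere, so the first differential of P is injective on
     that cohomology; but this is a nonzero module killed by m and the entries of
     the differential lie in m.
   So depth R is at least depth M + grade M, resp. depth M + depth R_p, which the hypotheses
   compare with dim R. For the converse M = R works, with a prime p starting a chain of
   maximal length, which is minimal and hence associated. *)
Require Import Defs.
From HB Require Import structures.
From mathcomp Require Import all_boot all_order all_algebra.
From mathcomp Require Import generic_quotient ring_quotient.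
From mathcomp Require Import ring zify.
From mathcomp Require Import boolp classical_sets.
From mathcomp Require Import constructive_ereal.

Set Implicit Arguments.
Unset Strict Implicit.
Unset Printing Implicit Defensive.

Import Order.TTheory GRing.Theory Num.Theory.
Local Open Scope ring_scope.

(** The [delta]-cochains play the role of Ext(R/m, -) without a resolution of R/m: their cohomology
    is killed by m, and in R it vanishes below degree t exactly when m contains a regular sequence
    of length t. Arguments by long exact sequences become explicit manipulations of cochains. The
    complex P is renumbered from its top, so that dropping a split injection only changes its
    beginning. The new first term is a quotient Q_1 / e(Q_0), and quotients by regular sequences
    occur as well; rather than form these modules, statements are made in the original ones modulo a
    predicate, and localization of the complex at p is replaced by multiplication by elements
    outside p. Minimality at the top means that some v has a functional mu with mu(v) = 1, while
    every functional takes e(v) into m. So a copy of R splits off the first term and the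
    differential maps it into multiples by m; the depth argument asks no more, and the other
    differentials may contain units. *)

Definition submod (R : pzRingType) (V : lmodType R) (B : V -> Prop) : Prop :=
  B 0 /\ forall a x y, B x -> B y -> B (a *: x + y).

Section Submod.
Variables (R : pzRingType) (V : lmodType R) (B : V -> Prop).
Hypothesis subB : submod B.

Lemma submod0 : B 0. Proof. by case: subB. Qed.

Lemma submodD x y : B x -> B y -> B (x + y).
Proof. by move=> Bx By; rewrite -[x]scale1r; apply: subB.2. Qed.

Lemma submodZ a x : B x -> B (a *: x).
Proof. by move=> Bx; rewrite -[_ *: _]addr0; apply: subB.2 => //; apply: submod0. Qed.

Lemma submodN x : B x -> B (- x).
Proof. by move=> Bx; rewrite -scaleN1r; apply: submodZ. Qed.

Lemma submodB x y : B x -> B y -> B (x - y).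
Proof. by move=> Bx By; apply: submodD => //; apply: submodN. Qed.

Lemma submod_sum (I : Type) (r : seq I) (F : I -> V) :
  (forall i, B (F i)) -> B (\sum_(i <- r) F i).
Proof. by move=> BF; apply: (big_ind B) => //; [apply: submod0 | apply: submodD]. Qed.

Lemma submodDr x y : B x -> B (x + y) -> B y.
Proof. by move=> Bx Bxy; rewrite -[y](addrK x) [y + x]addrC; apply: submodB. Qed.

Lemma submodBr x y : B y -> B (x - y) -> B x.
Proof. by move=> By Bxy; rewrite -[x](subrK y); apply: submodD. Qed.

Lemma submodBl x y : B x -> B (x - y) -> B y.
Proof. by move=> Bx Bxy; rewrite -[y](subKr x); apply: submodB. Qed.

End Submod.

Lemma submod_zero (R : pzRingType) (V : lmodType R) :
  submod (fun v : V => v = 0).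
Proof. by split=> // a x y -> ->; rewrite scaler0 addr0. Qed.

(** Dividing by this submodule is dividing [V / B] by [x]: iterated quotients by a sequence become
    iterated predicates on one module. *)
Definition adjoin (R : pzRingType) (V : lmodType R) (B : V -> Prop) (x : R) (v : V) :=
  exists b w, B b /\ v = b + x *: w.

Lemma submod_adjoin (R : comNzRingType) (V : lmodType R) (B : V -> Prop) (x : R) :
  submod B -> submod (adjoin B x).
Proof.
move=> subB; split; first by exists 0, 0; rewrite scaler0 addr0; split; first exact: submod0.
move=> a _ _ [b [w [Bb ->]]] [c [u [Bc ->]]].
exists (a *: b + c), (a *: w + u); split; first exact: subB.2.
by rewrite !scalerDr !scalerA [x * a]mulrC addrACA.
Qed.

(** * Ideals of Noetherian rings *)

Section Noetherian.
Variable R : comNzRingType.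
Implicit Types (I J : R^o -> Prop) (x y : R).

Section MkIdeal.
Variables (I : R^o -> Prop) (subI : submod I) (I1 : ~ I 1).

Definition ideal_pred : {pred R} := fun x => `[< I x >].

Lemma ideal_pred_closed : idealr_closed ideal_pred.
Proof.
split; first exact/asboolP/(submod0 subI).
  by apply/negP => /asboolP.
by move=> a u v /asboolP Iu /asboolP Iv; apply/asboolP; apply: subI.2.
Qed.

Definition mk_ideal : idealr R :=
  HB.pack_for (idealr R) ideal_pred (isIdealr.Build R ideal_pred ideal_pred_closed).

Lemma mk_idealE x : x \in mk_ideal <-> I x.
Proof. by split=> [/asboolP|Ix]; last exact/asboolP. Qed.

Hypothesis I_prime : forall x y, I (x * y) -> I x \/ I y.

Lemma ideal_pred_prime : prime_idealr_closed ideal_pred.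
Proof.
by move=> x y /asboolP /I_prime[] ?; apply/orP; [left|right]; apply/asboolP.
Qed.

Definition mk_prime : prime_idealr R :=
  HB.pack_for (prime_idealr R) ideal_pred
    (isIdealr.Build R ideal_pred ideal_pred_closed)
    (isPrimeIdealrClosed.Build R ideal_pred ideal_pred_prime).

Lemma mk_primeE x : x \in mk_prime <-> I x.
Proof. by split=> [/asboolP|Ix]; last exact/asboolP. Qed.

End MkIdeal.

Lemma submod_idealr (p : idealr R) : submod (fun x : R^o => x \in p).
Proof.
split; first exact: idealr0.
by move=> a x y px py; rewrite rpredD // idealMr.
Qed.

Hypothesis noethR : noetherian R.

Lemma noetherian_fg I : submod I ->
  exists n (g : 'I_n -> R), (forall i, I (g i)) /\
    forall x, I x -> exists c : 'I_n -> R, x = \sum_i c i * g i.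
Proof.
(* [noetherian] speaks of proper ideals; the unit ideal is generated by 1. *)
move=> subI; have [I1|I1] := pselect (I 1).
  exists 1%N, (fun=> 1); split=> // x Ix.
  by exists (fun=> x); rewrite big_ord1 mulr1.
have [n [g gP]] := noethR (mk_ideal subI I1).
exists n, g; split=> [i|x Ix].
  apply/(mk_idealE subI I1)/gP; exists (fun j => (j == i)%:R).
  rewrite (bigD1 i) //= eqxx mul1r big1 ?addr0 // => j /negPf ->.
  by rewrite mul0r.
by apply/gP/mk_idealE.
Qed.

(** Otherwise a choice of larger ideals gives a strictly increasing sequence; its union is finitely
    generated and the generators already lie in one term. *)
Lemma noetherian_max (Q : (R^o -> Prop) -> Prop) I0 :
    (forall I, Q I -> submod I) -> Q I0 ->
  exists I, [/\ Q I, forall x, I0 x -> I x &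
    forall J, Q J -> (forall x, I x -> J x) -> forall x, J x -> I x].
Proof.
move=> subQ QI0; apply: contrapT => noMax.
pose T := {I | Q I /\ forall x, I0 x -> I x}.
have step (I : T) : {J : T | (forall x, sval I x -> sval J x) /\
    exists x, sval J x /\ ~ sval I x}.
  apply: cid; apply: contrapT => noJ; case: I noJ => I [QI I0I] /= noJ.
  apply: noMax; exists I; split=> // J QJ IJ x Jx.
  apply: contrapT => Ix; apply: noJ.
  have TJ : Q J /\ forall x, I0 x -> J x by split=> // y /I0I /IJ.
  by exists (exist _ J TJ) => /=; split=> //; exists x.
pose c n : T := iter n (fun I : T => sval (step I)) (exist _ I0 (conj QI0 (fun _ Ix => Ix))).
have cS n x : sval (c n) x -> sval (c n.+1) x.
  by rewrite /c iterS; case: (step _) => J [/= h _]; apply: h.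
have c_mono m n x : (m <= n)%N -> sval (c m) x -> sval (c n) x.
  by move=> /subnKC <-; elim: (n - m)%N => [|k IH]; rewrite ?addn0 // addnS => /IH /cS.
pose U (x : R^o) := exists n, sval (c n) x.
have subU : submod U.
  split; first by exists 0%N; apply: (submod0 (subQ _ (proj1 (svalP (c 0%N))))).
  move=> a x y [m cx] [n cy]; exists (maxn m n).
  apply: (subQ _ (proj1 (svalP (c _)))).2.
    by apply: c_mono cx; apply: leq_maxl.
  by apply: c_mono cy; apply: leq_maxr.
have [n [g [Ug gP]]] := noetherian_fg subU.
have [h hP] := choice Ug.
pose N := \max_i h i.
have [_ [x [cx ncx]]] := svalP (step (c N)).
have [|d xE] := gP x; first by exists N.+1; rewrite /c iterS.
have subcN := subQ _ (proj1 (svalP (c N))).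
apply: ncx; rewrite xE; apply: (submod_sum subcN) => i.
by apply: (submodZ (V := R^o) subcN); apply: c_mono (hP i); apply: leq_bigmax.
Qed.

End Noetherian.

(** * Associated primes and regular elements *)

Section Colon.
Variables (R : comNzRingType) (I : R^o -> Prop).
Hypotheses (noethR : noetherian R) (subI : submod I).
Implicit Types (v w x y : R).

Definition colon v : R^o -> Prop := fun x => I (x * v).

Lemma submod_colon v : submod (colon v).
Proof.
split=> [|a x y]; rewrite /colon ?mul0r; first exact: submod0 subI.
move=> Ix Iy; rewrite mulrDl.
have -> : a *: x * v = a * (x * v) by rewrite mulrA.
exact: subI.2.
Qed.

(** [I : v] is then an associated prime of [R / I], maximal among the annihilators of nonzero
    classes. *)
Definition max_colon v : Prop := ~ I v /\
  forall w, ~ I w -> (forall x, colon v x -> colon w x) ->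
    forall x, colon w x -> colon v x.

(** [I : v] is contained in [I : (x * v)], so by maximality they agree as soon as [x * v] is outside
    [I]. *)
Lemma max_colon_prime v x y : max_colon v ->
  colon v (x * y) -> ~ colon v x -> colon v y.
Proof.
move=> [Iv maxv] Ixy Ix; apply: (maxv (x * v)) => [//|z Iz|].
  by rewrite /colon mulrCA; apply: (submodZ (V := R^o) subI).
by rewrite /colon mulrA [y * x]mulrC.
Qed.

Lemma max_colon_ex v : ~ I v ->
  exists w, max_colon w /\ forall x, colon v x -> colon w x.
Proof.
move=> Iv; pose Q (J : R^o -> Prop) := exists w, ~ I w /\ J = colon w.
have [||_ [[w [Iw ->]] vw maxw]] := @noetherian_max R noethR Q (colon v).
- by move=> _ [w [_ ->]]; apply: submod_colon.
- by exists v.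
exists w; split=> //; split=> // u Iu wu; apply: maxw => //.
by exists u.
Qed.

(** The witnesses for the single [v] are multiplied; the product stays outside [I : w] because that
    ideal is prime. *)
Lemma max_colon_separate (vs : seq R) w : max_colon w ->
    (forall v, v \in vs -> exists y, I (y * v) /\ ~ I (y * w)) ->
  exists y, (forall v, v \in vs -> I (y * v)) /\ ~ I (y * w).
Proof.
move=> maxw; elim: vs => [_|v vs IH vsP]; first by exists 1; rewrite mul1r; case: maxw.
have [v' v'vs|y [yvs yw]] := IH; first by apply: vsP; rewrite inE v'vs orbT.
have [z [zv zw]] := vsP v (mem_head _ _).
exists (y * z); split=> [v'|].
  rewrite inE => /predU1P[->|v'vs]; first by rewrite -mulrA; apply: (submodZ (V := R^o) subI).
  by rewrite [y * z]mulrC -mulrA; apply: (submodZ (V := R^o) subI); apply: yvs.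
by move=> Iyz; apply: zw; apply: (max_colon_prime maxw Iyz).
Qed.

Variable m : R^o -> Prop.
Hypotheses (subm : submod m) (Im : forall v, (forall x, m x -> I (x * v)) -> I v).

(** If the element [x] found for [vs] lies in [I : v], it is corrected by [y * z], where [z] in [m]
    is outside [I : v] and [y] is in every [I : v'] but not in [I : v]. Such a [y] exists because an
    inclusion between two maximal ideals of this kind is an equality, which [x] rules out. *)
Lemma prime_avoidance (vs : seq R) :
    (forall v, v \in vs -> max_colon v) ->
  exists x, m x /\ forall v, v \in vs -> ~ I (x * v).
Proof.
elim: vs => [_|v vs IH vsP]; first by exists 0; split; first exact: submod0 subm.
have [v' v'vs|x [mx xvs]] := IH; first by apply: vsP; rewrite inE v'vs orbT.
have [Ixv|nIxv] := pselect (I (x * v)); last first.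
  by exists x; split=> // v'; rewrite inE => /predU1P[->//|]; apply: xvs.
have maxv := vsP v (mem_head _ _).
have [v' v'vs|y [yvs yv]] := @max_colon_separate vs v maxv.
  apply: contrapT => noy; have maxv' := vsP v' (mem_behead (s := v :: vs) v'vs).
  apply: (xvs _ v'vs); apply: maxv'.2 Ixv => [|y Iyv']; first by case: maxv.
  by apply: contrapT => yv; apply: noy; exists y.
have [z [mz zv]] : exists z, m z /\ ~ I (z * v).
  apply: contrapT => noz; case: maxv => + _; apply; apply: Im => z mz.
  by apply: contrapT => zv; apply: noz; exists z.
exists (x + y * z); split; first by apply: (submodD subm) => //; apply: (submodZ (V := R^o) subm).
move=> v'; rewrite inE mulrDl => /predU1P[->|v'vs] Iv.
  have := submodDr (V := R^o) subI Ixv Iv => Iyz.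
  exact: zv (max_colon_prime maxv Iyz yv).
apply: (xvs _ v'vs); apply: (submodDr (V := R^o) subI) (_ : I (y * z * v')) _; last by rewrite addrC.
by rewrite [y * z]mulrC -mulrA; apply: (submodZ (V := R^o) subI); apply: yvs.
Qed.

(* An ideal generated by [I] and finitely many [v] with [I : v] maximal is chosen
   as large as possible: an element avoiding these [I : v] is then regular. *)
Lemma exists_regular : exists x, m x /\ forall v, I (x * v) -> I v.
Proof.
pose span (vs : seq R) (y : R^o) := exists c : 'I_(size vs) -> R, I (y - \sum_i c i * vs`_i).
have sub_span vs : submod (span vs).
  split; first by exists (fun=> 0); rewrite big1 ?subr0 => [|i _]; rewrite ?mul0r //; apply: submod0 subI.
  move=> a x y [c Ic] [d Id]; exists (fun i => a * c i + d i).
  have -> : a *: x + y - \sum_i (a * c i + d i) * vs`_i =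
      a *: (x - \sum_i c i * vs`_i) + (y - \sum_i d i * vs`_i) :> R^o.
    rewrite scalerBr addrACA -opprD; congr (_ - _).
    rewrite scaler_sumr -big_split; apply: eq_bigr => i _.
    by rewrite mulrDl -mulrA.
  exact: subI.2.
pose Q J := exists vs : seq R, (forall v, v \in vs -> max_colon v) /\ J = span vs.
have [||_ [[vs [vsP ->]] _ maxvs]] := @noetherian_max R noethR Q (span [::]).
- by move=> _ [vs [_ ->]].
- by exists [::].
have [x [mx xvs]] := prime_avoidance vsP.
exists x; split=> // u Ixu; apply: contrapT => Iu.
have [w [maxw uw]] := max_colon_ex Iu.
have [c Ic] : span vs w.
  apply: (maxvs (span (w :: vs))).
  - exists (w :: vs); split=> // v; rewrite inE => /predU1P[->//|]; exact: vsP.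
  - move=> y [c Ic]; exists (fun i => if unlift ord0 i is Some j then c j else 0).
    rewrite big_ord_recl unlift_none mul0r add0r.
    by under eq_bigr do rewrite liftK.
  - exists (fun i => (i == ord0)%:R); rewrite big_ord_recl eqxx mul1r /=.
    rewrite big1 ?addr0 ?subrr => [|i _]; first exact: submod0 subI.
    by rewrite mul0r.
(* An inclusion of some [I : v] in [I : w] would be an equality and put [x] in [I : v]. So some [y]
   kills [vs] modulo [I] but not [w], although [w] lies in the span of [vs] and [I]. *)
have [v vvs|y [yvs yw]] := @max_colon_separate vs w maxw.
  apply: contrapT => noy; apply: (xvs v vvs).
  apply: (vsP v vvs).2 (uw _ Ixu); first by case: maxw.
  by move=> y Iy; apply: contrapT => yw; apply: noy; exists y.
apply: yw; apply: (submodBr (V := R^o) subI) (_ : I (y *: _)) _; last first.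
  by rewrite -mulrBr; apply: (submodZ (V := R^o) subI); apply: Ic.
rewrite scaler_sumr; apply: (submod_sum (V := R^o) subI) => i.
rewrite -[_ *: _]/(y * _) mulrCA; apply: (submodZ (V := R^o) subI).
by apply: yvs; apply: mem_nth.
Qed.

End Colon.

(** * Maximal, minimal and intermediate primes *)

Section LocalRing.
Variable R : comNzRingType.
Hypothesis noethR : noetherian R.

Lemma exists_maximal_ideal (I : R^o -> Prop) : submod I -> ~ I 1 ->
  exists m : idealr R, maximal_ideal m /\ forall x, I x -> x \in m.
Proof.
move=> subI I1; pose Q (J : R^o -> Prop) := submod J /\ ~ J 1.
have [||J [[subJ J1] IJ maxJ]] := @noetherian_max R noethR Q I.
- by move=> J [].
- by [].
exists (mk_ideal subJ J1); split=> [K mK x xK|x /IJ]; last by move/(mk_idealE subJ J1).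
apply/(mk_idealE subJ J1); apply: (maxJ (fun x => x \in K)) => //.
  by split; [exact: submod_idealr | rewrite idealr1].
by move=> y /(mk_idealE subJ J1)/mK.
Qed.

Lemma local_maximal_ideal : local R ->
  exists m : prime_idealr R, (forall x, x \notin m -> exists y, y * x = 1) /\
    forall x, in_max_ideal x <-> x \in m.
Proof.
move=> [m maxm uniqm].
have unit_m x : x \notin m -> exists y, y * x = 1.
  move=> xm; apply: contrapT => nounit.
  pose I := adjoin (fun z : R^o => z = 0) x.
  have [||m' [maxm' Im']] := @exists_maximal_ideal I.
  - exact/submod_adjoin/submod_zero.
  - by case=> b [w [-> /esym]]; rewrite add0r => xw; apply: nounit; exists w; rewrite mulrC.
  move: xm; rewrite -(uniqm _ maxm') Im' //.
  by exists 0, 1; split=> //; rewrite add0r [RHS]mulr1.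
have m1 : ~ 1 \in m by rewrite idealr1.
have m_prime x y : x * y \in m -> x \in m \/ y \in m.
  move=> xym; have [xm|/unit_m[z zx]] := boolP (x \in m); [by left | right].
  by rewrite -[y]mul1r -zx -mulrA idealMr.
have mE x : x \in mk_prime (submod_idealr m) m1 m_prime = (x \in m).
  by apply/idP/idP => [|xm]; [move/(mk_primeE (submod_idealr m) m1 m_prime) | apply/mk_primeE].
exists (mk_prime (submod_idealr m) m1 m_prime); split=> x; rewrite mE; first exact: unit_m.
by split=> [[m' /uniqm <-]|xm]; last exists m.
Qed.

(** An annihilator [ann x] maximal among those contained in [p] is prime: if [a * x] is killed by
    some [s] outside [p], compare with [ann (s * x)]; otherwise compare with [ann (a * x)], which is
    still inside [p]. Minimality of [p] turns the inclusion into an equality. *)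
Lemma minimal_prime_associated (p : prime_idealr R) :
    (forall q : prime_idealr R, {subset q <= p} -> {subset p <= q}) ->
  exists x : R, forall a, a \in p <-> a * x = 0.
Proof.
move=> minp.
pose ann (x : R) : R^o -> Prop := colon (fun z : R^o => z = 0) x.
have sub_ann x : submod (ann x) by apply/submod_colon/submod_zero.
pose Q (J : R^o -> Prop) := exists x, J = ann x /\ forall a, ann x a -> a \in p.
have [||_ [[x [-> annp]] _ maxx]] := @noetherian_max R noethR Q (ann 1).
- by move=> _ [x [-> _]].
- by exists 1; split=> // a; rewrite /ann /colon mulr1 => ->; apply: idealr0.
have ann1 : ~ ann x 1 by move/annp; rewrite idealr1.
have ann_prime a b : ann x (a * b) -> ann x a \/ ann x b.
  rewrite /ann /colon => abx.
  have [[s [sp sax]]|nos] := pselect (exists s, s \notin p /\ s * (a * x) = 0).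
    left; apply: (maxx (ann (s * x))).
    - exists (s * x); split=> // t; rewrite /ann /colon mulrA => /annp.
      by rewrite prime_idealrM (negPf sp) orbF.
    - by move=> t; rewrite /ann /colon mulrCA => ->; rewrite mulr0.
    - by rewrite /ann /colon mulrCA.
  right; apply: (maxx (ann (a * x))).
  - exists (a * x); split=> // t tax; apply: contrapT => /negP tp.
    by apply: nos; exists t.
  - by move=> t; rewrite /ann /colon mulrCA => ->; rewrite mulr0.
  - by rewrite /ann /colon mulrCA mulrA.
pose q := mk_prime (sub_ann x) ann1 ann_prime.
have qp : {subset q <= p} by move=> a /(mk_primeE (sub_ann x) ann1 ann_prime)/annp.
exists x => a; split=> [/(minp q qp)/mk_primeE //|ax].
exact: annp.
Qed.

(* A prime below [q] avoiding [x] is an ideal maximal among those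
   disjoint from the elements [s * x ^+ n] with [s] outside [q]. *)
Lemma exists_prime_below (q : prime_idealr R) (I : R^o -> Prop) (x : R) :
    submod I -> (forall v, I v -> v \in q) -> (forall v, I (x * v) -> I v) ->
  exists p : prime_idealr R,
    [/\ {subset p <= q}, forall v, I v -> v \in p & x \notin p].
Proof.
move=> subI Iq Ix.
pose Q (J : R^o -> Prop) := submod J /\ forall s n, s \notin q -> ~ J (s * x ^+ n).
have [||J [[subJ Jdisj] IJ maxJ]] := @noetherian_max R noethR Q I.
- by move=> J [].
- split=> // s n sq; elim: n => [|n IH]; first by rewrite expr0 mulr1 => /Iq; apply/negP.
  by rewrite exprS mulrCA => /Ix.
have J1 : ~ J 1 by have /= := Jdisj 1 0%N; rewrite expr0 mulr1 idealr1; apply.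
have J_meets a : ~ J a -> exists s n b, [/\ s \notin q, J b & exists c, s * x ^+ n = b + a * c].
  move=> Ja; apply: contrapT => noS; apply: Ja.
  apply: (maxJ (adjoin J a)).
  - split; first exact: submod_adjoin.
    by move=> s n sq [b [c [Jb E]]]; apply: noS; exists s, n, b; split=> //; exists c.
  - by move=> b Jb; exists b, 0; rewrite scaler0 addr0.
  - by exists 0, 1; split; [exact: submod0 subJ | rewrite add0r [RHS]mulr1].
have J_prime a b : J (a * b) -> J a \/ J b.
  move=> Jab; apply: contrapT => /not_orP[/J_meets[s [n [u [sq Ju [c E]]]]]].
  move=> /J_meets[t [l [v [tq Jv [d F]]]]].
  apply: (Jdisj (s * t) (n + l)%N); first by rewrite prime_idealrM negb_or sq.
  have -> : s * t * x ^+ (n + l) = (v + b * d) * u + (a * c * v + (c * d) * (a * b)).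
    by rewrite exprD mulrACA E F; ring.
  by do !apply: (submodD subJ); apply: (submodZ (V := R^o) subJ).
exists (mk_prime subJ J1 J_prime); split=> [v /(mk_primeE subJ J1 J_prime) Jv|v Iv|].
- apply: contrapT => /negP vq; apply: (Jdisj v 0%N vq).
  by rewrite expr0 mulr1.
- exact/mk_primeE/IJ.
- apply/negP => /(mk_primeE subJ J1 J_prime) Jx; apply: (Jdisj 1 1%N).
    by rewrite idealr1.
  by rewrite mul1r expr1.
Qed.

End LocalRing.

(** * Cochains and regular sequences *)

Section Cochains.
Variable R : comNzRingType.
Implicit Types (V W : lmodType R) (x : R) (w : seq R).

(* Cochains are functions on words with letters in an ideal [m]; they form the complex
   Hom(F, V) where F is a complex of free modules with F_0 = R, with d(F_1) = m,
   and on which every element of [m] is null-homotopic by [delta_cons]. *)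
Fixpoint delta V (phi : seq R -> V) w : V :=
  if w is x :: w' then x *: phi w' - delta (fun u => phi (x :: u)) w' else 0.

Lemma deltaD V (phi psi : seq R -> V) w :
  delta (fun u => phi u + psi u) w = delta phi w + delta psi w.
Proof.
elim: w phi psi => [|x w IH] phi psi /=; first by rewrite addr0.
by rewrite IH scalerDr opprD addrACA.
Qed.

Lemma deltaB V (phi psi : seq R -> V) w :
  delta (fun u => phi u - psi u) w = delta phi w - delta psi w.
Proof.
elim: w phi psi => [|x w IH] phi psi /=; first by rewrite subrr.
by rewrite IH scalerBr !opprB addrACA [RHS]addrACA [- _ + _]addrC.
Qed.

Lemma delta_linear V W (f : {linear V -> W}) (phi : seq R -> V) w :
  delta (fun u => f (phi u)) w = f (delta phi w).
Proof.
elim: w phi => [|x w IH] phi /=; first by rewrite linear0.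
by rewrite IH linearB linearZ.
Qed.

Lemma delta_scalel V (phi : seq R -> R^o) (v : V) w :
  delta (fun u => phi u *: v) w = delta phi w *: v.
Proof.
elim: w phi => [|x w IH] phi /=; first by rewrite scale0r.
by rewrite IH scalerBl scalerA.
Qed.

Lemma deltaZ V a (phi : seq R -> V) w :
  delta (fun u => a *: phi u) w = a *: delta phi w.
Proof.
elim: w phi => [|x w IH] phi /=; first by rewrite scaler0.
by rewrite IH scalerBr !scalerA mulrC.
Qed.

Lemma delta_sum V (I : Type) (r : seq I) (phi : I -> seq R -> V) w :
  delta (fun u => \sum_(i <- r) phi i u) w = \sum_(i <- r) delta (phi i) w.
Proof.
elim: w phi => [|x w IH] phi /=; first by rewrite big1.
by rewrite IH scaler_sumr -sumrB.
Qed.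

Lemma delta_delta V (phi : seq R -> V) w : delta (delta phi) w = 0.
Proof.
elim: w phi => //= x w IH phi.
by rewrite (deltaB (fun u => x *: phi u)) deltaZ IH subr0 subrr.
Qed.

(** A cochain of degree [l] is a function on all sequences of which only the values on these words
    count; neither [m] nor the degree is part of its type. *)
Definition word (m : {pred R}) (l : nat) : pred (seq R) :=
  fun w => (size w == l) && all [in m] w.

Lemma word0 m w : w \in word m 0 -> w = [::].
Proof. by case/andP=> /nilP. Qed.

Lemma word_cons m l x w : (x :: w \in word m l.+1) = (x \in m) && (w \in word m l).
Proof. by rewrite !unfold_in /= andbCA. Qed.

Lemma delta_submod V (B : V -> Prop) m l phi : submod B ->
    (forall w, w \in word m l -> B (phi w)) ->
  forall w, w \in word m l.+1 -> B (delta phi w).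
Proof.
move=> subB; elim: l phi => [|l IH] phi Bphi [|x w]; rewrite ?word_cons //.
  case/andP=> _ /word0 -> /=; rewrite subr0; apply: submodZ => //.
  exact: Bphi.
case/andP=> xm wm /=; apply: (submodB subB).
  by apply: (submodZ subB); apply: Bphi.
apply: IH wm => u um; apply: Bphi.
by rewrite word_cons xm.
Qed.

Lemma eq_delta V m l (phi psi : seq R -> V) :
    (forall w, w \in word m l -> phi w = psi w) ->
  forall w, w \in word m l.+1 -> delta phi w = delta psi w.
Proof.
move=> eqp w wm; apply/eqP; rewrite -subr_eq0 -deltaB; apply/eqP.
apply: (@delta_submod _ (fun v => v = 0)) wm; first exact: submod_zero.
by move=> u um; rewrite eqp ?subrr.
Qed.

Lemma delta_cons V (phi : seq R -> V) x w :
  x *: phi w = delta phi (x :: w) + delta (fun u => phi (x :: u)) w.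
Proof. by rewrite /= subrK. Qed.

(* The cohomology of the cochains in [Z / B] vanishes in degrees below [t]. *)
Definition acyclic (m : {pred R}) (t : nat) V (Z B : V -> Prop) : Prop :=
  forall l phi, (l < t)%N ->
    (forall w, w \in word m l -> Z (phi w)) ->
    (forall w, w \in word m l.+1 -> B (delta phi w)) ->
  exists psi, forall w, w \in word m l -> B (phi w - delta psi w).

Lemma acyclic_leq m s t V (Z B : V -> Prop) :
  (s <= t)%N -> acyclic m t Z B -> acyclic m s Z B.
Proof. by move=> st acy l phi ls; apply/acy/(leq_trans ls). Qed.

(** Weak regularity on [V / B]: it does not include that the last quotient is nonzero. *)
Fixpoint regular_mod V (B : V -> Prop) (s : seq R) : Prop :=
  if s is x :: s' then
    (forall v, B (x *: v) -> B v) /\ regular_mod (adjoin B x) s'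
  else True.

(** By the homotopy formula [x *: phi] is [delta] of the contraction [phi (x :: _)] modulo [B]. The
    contraction is a cocycle modulo [x], hence by induction of the form [delta k + x *: eta] modulo
    [B]. Applying [delta] and cancelling [x] gives [phi = delta eta] modulo [B]. *)
Lemma regular_acyclic m V (B : V -> Prop) s :
  submod B -> all [in m] s -> regular_mod B s ->
  acyclic m (size s) (fun=> True) B.
Proof.
elim: s B => [|x s IH] B subB /=; first by move=> _ _ l.
case/andP=> xm sm [regx regs] l phi ls _ Bphi.
have xphi w : w \in word m l -> B (x *: phi w - delta (fun u => phi (x :: u)) w).
  by move=> wm; apply: (Bphi (x :: w)); rewrite word_cons xm.
case: l ls Bphi xphi => [|l] ls Bphi xphi.
  exists (fun=> 0) => w wm; have := xphi w wm; rewrite (word0 wm) /= !subr0.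
  exact: regx.
have [//||k kP] := IH _ (submod_adjoin x subB) sm regs l (fun u => phi (x :: u)) ls.
  move=> w wm; exists (delta (fun u => phi (x :: u)) w - x *: phi w), (phi w).
  split; last by rewrite subrK.
  by rewrite -opprB; apply: (submodN subB); apply: xphi.
have /choice[eta etaP] : forall w, exists v, w \in word m l ->
    B (phi (x :: w) - delta k w - x *: v).
  move=> w; have [wm|] := boolP (w \in word m l); last by exists 0.
  by have [b [v [Bb E]]] := kP w wm; exists v; rewrite E addrK.
exists eta => w wm; apply: regx; rewrite scalerBr -deltaZ.
have := delta_submod subB etaP wm.
rewrite deltaB deltaB delta_delta subr0 => Bd.
by rewrite -[_ - _](subrKA (delta (fun u => phi (x :: u)) w)); apply: (submodD subB) => //; apply: xphi.
Qed.

Section Depth.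
Variables (m : idealr R).
Hypothesis noethR : noetherian R.
Implicit Types I : R^o -> Prop.

(** Acyclicity in degree 0 says that [m] kills no nonzero class of [R / I], which is the hypothesis
    of [exists_regular]. *)
Lemma acyclic_exists_regular I : submod I -> acyclic m 1 (fun=> True) I ->
  exists x, x \in m /\ forall v, I (x * v) -> I v.
Proof.
move=> subI acy; apply: (exists_regular noethR subI (submod_idealr m)) => v vI.
have [//|//||psi] := @acy 0%N (fun=> v).
  move=> [|x [|y w]]; rewrite ?word_cons ?andbF //.
  by case/andP=> xm _; rewrite /= subr0; apply: vI.
by move=> /(_ [::]); rewrite /= subr0; apply.
Qed.

(** The connecting map for multiplication by [x] on [R / I]: [delta phi] is [x *: eta] modulo [I]
    with [eta] a cocycle one degree higher. If [eta = delta k], then [phi - x *: k] is a cocycle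
    modulo [I]. *)
Lemma acyclic_adjoin I t x : submod I -> (forall v, I (x * v) -> I v) ->
  acyclic m t.+1 (fun=> True) I -> acyclic m t (fun=> True) (adjoin I x).
Proof.
move=> subI regx acy l phi lt _ phiP.
have /choice[eta etaP] : forall w, exists v, w \in word m l.+1 ->
    I (delta phi w - x *: v).
  move=> w; have [wm|] := boolP (w \in word m l.+1); last by exists 0.
  by have [b [v [Ib E]]] := phiP w wm; exists v; rewrite E addrK.
have [//|//||k kP] := acy l.+1 eta.
  move=> w wm; apply: regx; have := delta_submod subI etaP wm.
  rewrite deltaB delta_delta deltaZ sub0r => /(submodN subI).
  by rewrite opprK.
have [|//||psi psiP] := acy l (fun w => phi w - x *: k w).
- exact: ltnW.
- move=> w wm; rewrite deltaB deltaZ -[_ - _](subrKA (x *: eta w)).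
  apply: (submodD subI); first exact: etaP.
  by rewrite -scalerBr; apply: (submodZ subI); apply: kP.
exists psi => w wm; exists (phi w - x *: k w - delta psi w), (k w).
split; first exact: psiP.
by rewrite addrAC subrK.
Qed.

Lemma acyclic_regular I t : submod I -> acyclic m t (fun=> True) I ->
  exists s, [/\ size s = t, all [in m] s & regular_mod I s].
Proof.
elim: t I => [|t IH] I subI acy; first by exists [::].
have [|x [xm regx]] := acyclic_exists_regular subI; first exact: acyclic_leq acy.
have [s [<- sm regs]] := IH _ (submod_adjoin x subI) (acyclic_adjoin subI regx acy).
by exists (x :: s); rewrite /= xm.
Qed.

(** Otherwise take an ideal [I] inside [m], maximal among those with [R / I] acyclic in all degrees.
    With [x] in [m] regular modulo [I], the ideal [adjoin I x] has the same property, so [x] is in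
    [I], and regularity puts 1 in [I]. *)
Lemma acyclic_bounded : exists t, ~ acyclic m t (fun=> True) (fun z : R^o => z = 0).
Proof.
apply: contrapT => acy.
pose Q I := [/\ submod I, forall x, I x -> x \in m &
  forall t, acyclic m t (fun=> True) I].
have [||I [[subI Im acyI] _ maxI]] := @noetherian_max R noethR Q (fun z => z = 0).
- by move=> I [].
- split; first exact: submod_zero; first by move=> _ ->; apply: idealr0.
  by move=> t; apply: contrapT => nacy; apply: acy; exists t.
have [x [xm regx]] := acyclic_exists_regular subI (acyI 1%N).
have /regx /Im : I (x * 1).
  rewrite mulr1; apply: (maxI (adjoin I x)) => [|y Iy|].
  - split; first exact: submod_adjoin.
      by move=> _ [b [v [/Im bm ->]]]; rewrite rpredD // [_ *: _]mulrC idealMr.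
    by move=> t; apply: acyclic_adjoin.
  - by exists y, 0; rewrite scaler0 addr0.
  - by exists 0, 1; split; [exact: submod0 subI | rewrite add0r [RHS]mulr1].
by rewrite idealr1.
Qed.

End Depth.
End Cochains.

Definition mk_linear (R : comNzRingType) (U V : lmodType R) (f : U -> V)
    (f_lin : linear f) : {linear U -> V} :=
  HB.pack_for {linear U -> V} f (GRing.isLinear.Build R U V *:%R f f_lin).

(** * Complexes of projective modules *)

Section DualBasis.
Variable R : comNzRingType.
Implicit Types (U V : lmodType R).

Definition dual_basis V (B : V -> Prop) n
    (lam : 'I_n -> {linear V -> R^o}) (q : 'I_n -> V) : Prop :=
  (forall i b, B b -> lam i b = 0) /\ forall v, B (v - \sum_i lam i v *: q i).

(* The quotient [V / B] is finitely generated projective. *)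
Definition projective_mod V (B : V -> Prop) : Prop :=
  exists n lam q, @dual_basis V B n lam q.

Lemma fg_projective_mod V : finitely_generated V -> projective V ->
  projective_mod (fun v : V => v = 0).
Proof.
move=> [n [g gP]] projV.
pose f (c : {ffun 'I_n -> R^o}) := \sum_i c i *: g i.
have f_lin : linear f.
  move=> a c d; rewrite scaler_sumr -big_split; apply: eq_bigr => i _.
  by rewrite !ffunE scalerDl scalerA.
have [b|h hP] := projV _ _ (mk_linear f_lin) idfun.
  have [c ->] := gP b; exists [ffun i => c i]; apply: eq_bigr => i _.
  by rewrite ffunE.
have lam_lin i : linear (fun v => h v i) by move=> a u v; rewrite linearP !ffunE.
exists n, (fun i => mk_linear (lam_lin i)), g; split=> [i b ->|v].
  by rewrite linear0.
by rewrite -{1}[v]hP subrr.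
Qed.

Lemma dual_basis_redundant V (B : V -> Prop) n lam q (j : 'I_n.+1) (c : 'I_n -> R) :
    submod B -> dual_basis B lam q ->
    B (q j - \sum_i c i *: q (lift j i)) ->
  exists lam', dual_basis B lam' (fun i => q (lift j i)).
Proof.
move=> subB [lamB lamP] cP.
have lam_lin i : linear (fun v => lam (lift j i) v + c i * lam j v : R^o).
  move=> a u v; rewrite !linearP scalerDr mulrDr addrACA; congr (_ + _); congr (_ + _).
  exact: mulrCA.
exists (fun i => mk_linear (lam_lin i)); split=> [i b Bb|v] /=.
  by rewrite !lamB // mulr0 addr0.
have := submodD subB (lamP v) (submodZ subB (lam j v) cP).
rewrite (bigD1_ord j) //= scalerBr opprD [v + _]addrA addrACA subrK -opprD.
rewrite scaler_sumr -big_split; congr (B (_ - _)).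
by apply: eq_bigr => i _; rewrite scalerA [lam j v * _]mulrC [RHS]scalerDl.
Qed.

Variable m : idealr R.
Hypothesis unit_m : forall x, x \notin m -> exists y, y * x = 1.

(* Induction on the size of the dual basis: either a generator is redundant, or some
   unimodular [v] has a unimodular image and [U / B] is replaced by [U / (B + R v)]. *)
Lemma split_or_minimal U V (B : U -> Prop) (e : {linear U -> V}) :
    submod B -> (forall b, B b -> e b = 0) -> projective_mod B ->
  (exists v (mu : {linear U -> R^o}),
     [/\ forall b, B b -> mu b = 0, mu v = 1 &
         forall nu : {linear V -> R^o}, nu (e v) \in m]) \/
  (exists r : {linear V -> U}, forall v, B (r (e v) - v)).
Proof.
move=> subB eB [n [lam [q]]].
elim: n B lam q e subB eB => [|n IH] B lam q e subB eB basisB.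
  right; exists \0 => v; rewrite sub0r; apply: (submodN subB).
  by have := basisB.2 v; rewrite big_ord0 subr0.
have [in_m|] := pselect (forall i j, lam j (q i) \in m).
  (* Nakayama: [1 - lam ord0 (q ord0)] is a unit, which makes [q ord0] a combination of the other
     generators. *)
  have [u uE] : exists u, u * (1 - lam ord0 (q ord0)) = 1.
    apply: unit_m; apply/negP => um; have := idealr1 m.
    by rewrite -(subrK (lam ord0 (q ord0)) 1) rpredD.
  have [|lam' basis'] := @dual_basis_redundant U B n lam q ord0
      (fun i => u * lam (lift ord0 i) (q ord0)) subB basisB.
    have := submodZ subB u (basisB.2 (q ord0)).
    rewrite big_ord_recl opprD addrA -{1}[q ord0]scale1r -scalerBl scalerBr scalerA uE.
    by rewrite scale1r scaler_sumr; under eq_bigr do rewrite scalerA.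
  exact: IH basis'.
move=> /existsNP[i /existsNP[j /negP/unit_m[y yE]]].
pose v := y *: q i; have lamv : lam j v = 1 by rewrite linearZ.
have [evm|] := pselect (forall nu : {linear V -> R^o}, nu (e v) \in m).
  by left; exists v, (lam j); split=> // b; apply: basisB.1.
move=> /existsNP[nu /negP/unit_m[z zE]].
pose mu w := z * nu w.
have muP a u w : mu (a *: u + w) = a * mu u + mu w.
  by rewrite /mu linearP mulrDr; congr (_ + _); apply: mulrCA.
have mu0 : mu 0 = 0 by rewrite /mu linear0 mulr0.
pose p u := u - mu (e u) *: v.
have p_lin : linear p.
  by move=> a u w; rewrite /p linearP muP scalerDl -scalerA opprD addrACA scalerBr.
have [pi piE] : exists pi : {linear U -> U}, forall u, pi u = u - mu (e u) *: v.
  by exists (mk_linear p_lin).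
have piB b : B b -> pi b = b by move=> /eB E; rewrite piE E mu0 scale0r subr0.
have piv : pi v = 0 by rewrite piE /mu zE scale1r subrr.
have pipi u : pi (pi u) = pi u.
  by rewrite [pi u in LHS]piE linearB linearZ_LR piv scaler0 subr0.
(* [pi] is the projection along [v], so [B'] is [B + R v]. Modulo it [q j] is redundant, since its
   coefficient in [v] is [lam j v = 1]. *)
pose B' u := B (pi u).
have BB' b : B b -> B' b by move=> Bb; rewrite /B' piB.
have subB' : submod B'.
  split; first by rewrite /B' linear0; apply: submod0 subB.
  by move=> a u w Bu Bw; rewrite /B' linearP; apply: subB.2.
pose e' : {linear U -> V} := e \o pi.
have basis' : dual_basis B' (fun l => lam l \o pi : {linear U -> R^o}) q.
  split=> [l b|u]; first exact: basisB.1.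
  have /= := basisB.2 (pi u); set s := \sum_l _ => Bs.
  have E : pi (u - s) = pi (pi u - s) by rewrite !linearB pipi.
  by rewrite /B' [pi _]E piB.
have [|lam' basis2] := @dual_basis_redundant U B' n _ q j (fun l => - lam (lift j l) v) subB' basis'.
  have Bv : B' v by rewrite /B' piv; apply: submod0 subB.
  have := submodBl subB' Bv (BB' _ (basisB.2 v)).
  rewrite (bigD1_ord j) //= lamv scale1r; congr (B' (_ + _)).
  by rewrite -sumrN; apply: eq_bigr => l _; rewrite scaleNr opprK.
have e'B b : B' b -> e' b = 0 by move=> /eB.
have [[w [mu' [mu'B mu'w w_m]]]|[r rP]] := IH B' lam' _ e' subB' e'B basis2.
  left; exists (pi w), mu'; split=> [b /BB' /mu'B //||//].
  rewrite -mu'w; apply/eqP; rewrite -subr_eq0 -linearB; apply/eqP/mu'B.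
  by rewrite /B' linearB pipi subrr; apply: submod0 subB.
(* The retraction for [e]: [mu] recovers the coordinate along [v] and [r] the rest. *)
have r_lin : linear (fun y' => mu y' *: v + pi (r (y' - mu y' *: e v))).
  move=> a x y'; rewrite muP scalerDl -scalerA scalerDr addrACA; congr (_ + _).
  by rewrite -!linearP scalerDl -scalerA opprD addrACA scalerBr.
right; exists (mk_linear r_lin) => u /=.
have <- : e (pi u) = e u - mu (e u) *: e v by rewrite piE linearB linearZ_LR.
have := rP u; rewrite /B' linearB /=; congr B.
have {2}-> := piE u; by rewrite opprB addrCA addrA.
Qed.

End DualBasis.

Section AcyclicProjective.
Variables (R : comNzRingType) (m : {pred R}) (t : nat).
Hypothesis acyR : acyclic m t (fun=> True) (fun z : R^o => z = 0).

Lemma acyclic_projective (V : lmodType R) :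
  projective_mod (fun v : V => v = 0) ->
  acyclic m t (fun=> True) (fun v : V => v = 0).
Proof.
move=> [n [lam [q [_ lamP]]]] l phi lt _ phi0.
have /choice[psi psiP] : forall i, exists psi : seq R -> R^o, forall w, w \in word m l ->
    lam i (phi w) - delta psi w = 0.
  move=> i; apply: (acyR (phi := fun w => lam i (phi w))) => // w wm.
  by rewrite delta_linear phi0 // linear0.
exists (fun w => \sum_i psi i w *: q i) => w wm.
rewrite delta_sum -{1}[phi w](subrK (\sum_i lam i (phi w) *: q i)) lamP add0r -sumrB.
rewrite big1 // => i _.
by rewrite delta_scalel -scalerBl psiP // scale0r.
Qed.

End AcyclicProjective.

(** Boundaries of a complex whose first term is [Q 0 / B0]; when that term is dropped, the image of
    [e 0] becomes the new [B0]. *)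
Definition Bd (R : comNzRingType) (Q : nat -> lmodType R) (e : forall i, {linear Q i -> Q i.+1})
    (B0 : Q 0%N -> Prop) i : Q i -> Prop :=
  match i with
  | 0 => B0
  | i'.+1 => fun x => exists y, e i' y = x
  end.
Arguments Bd [R Q] e B0 i _.

(** * Acyclicity of R from a complex that is minimal at its start *)

Section Cocomplex.
Variable R : comNzRingType.

Variables (Q : nat -> lmodType R) (e : forall i, {linear Q i -> Q i.+1}).
Variable B0 : Q 0%N -> Prop.
Hypotheses (subB0 : submod B0) (eB0 : forall b, B0 b -> e 0%N b = 0).
Hypothesis ee0 : forall i x, e i.+1 (e i x) = 0.
Hypothesis projQ : forall i, projective_mod (fun x : Q i.+1 => x = 0).

Lemma submod_Bd i : submod (Bd e B0 i).
Proof.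
case: i => //= i; split=> [|a _ _ [x <-] [y <-]]; first by exists 0; rewrite linear0.
by exists (a *: x + y); rewrite linearP.
Qed.

Lemma e_Bd i b : Bd e B0 i b -> e i b = 0.
Proof. by case: i b => [|i] b /=; [apply: eB0 | case=> y <-; apply: ee0]. Qed.

Variables (m : idealr R) (T sigma : nat).
Hypothesis exactQ : forall i x, (i < sigma)%N -> e i x = 0 -> Bd e B0 i x.
Hypothesis acyQ : forall i, (sigma <= i)%N -> acyclic m T (fun x => e i x = 0) (Bd e B0 i).

Let acy t := acyclic m t (fun=> True) (fun z : R^o => z = 0).

Lemma delta0 (V : lmodType R) w : delta (fun=> 0 : V) w = 0.
Proof. by elim: w => //= x w ->; rewrite scaler0 subr0. Qed.

(** Below [sigma] there is no homology; from [sigma] on, a total degree less than [T + sigma] forces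
    [l < T]. *)
Lemma homology_acyclic i l theta : (l + i < T + sigma)%N ->
    (forall w, w \in word m l -> e i (theta w) = 0) ->
    (forall w, w \in word m l.+1 -> Bd e B0 i (delta theta w)) ->
  exists k, forall w, w \in word m l -> Bd e B0 i (theta w - delta k w).
Proof.
move=> li etheta dtheta; have [si|is_] := leqP sigma i; last first.
  exists (fun=> 0) => w wm; rewrite delta0 subr0.
  exact/exactQ/etheta.
by apply: (acyQ si) => //; lia.
Qed.

(** A chase in the double complex of cochains in the [Q i]. Acyclicity of [Q i.+2] gives
    [e theta1 = delta theta2]; by induction [theta1 - delta rho1] is killed by [e], hence equals
    [e rho + delta k] by [homology_acyclic]. Then [delta (e rho) = delta theta1 = e theta]. *)
Lemma lift_cocycle t i l (theta : seq R -> Q i) (theta1 : seq R -> Q i.+1) :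
    acy t -> (t < T + sigma)%N -> (l + i = t)%N ->
    (forall w, w \in word m l -> e i (theta w) = delta theta1 w) ->
  exists rho, forall w, w \in word m l -> e i (theta w - delta rho w) = 0.
Proof.
move=> acyt tT; elim: l i theta theta1 => [|l IH] i theta theta1 lit thetaE.
  exists (fun=> 0) => w wm; rewrite delta0 subr0 thetaE //.
  by rewrite (word0 wm).
have et1 w : w \in word m l.+1 -> delta (fun u => e i.+1 (theta1 u)) w = 0.
  by move=> wm; rewrite delta_linear -thetaE ?ee0.
have acy_i := acyclic_projective acyt (projQ i.+1).
have [|//|theta2 theta2P] := acy_i l (fun u => e i.+1 (theta1 u)) _ _ et1; first lia.
have [||rho1 rho1P] := IH i.+1 theta1 theta2; first lia.
  by move=> w wm; apply/eqP; rewrite -subr_eq0 theta2P.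
have [|//||k kP] := @homology_acyclic i.+1 l (fun w => theta1 w - delta rho1 w); first lia.
  by move=> w wm; exists (theta w); rewrite deltaB delta_delta subr0 thetaE.
have /choice[rho rhoP] : forall w, exists y, w \in word m l ->
    e i y = theta1 w - delta rho1 w - delta k w.
  move=> w; have [wm|] := boolP (w \in word m l); last by exists 0.
  by have [y yE] := kP w wm; exists y.
exists rho => w wm; rewrite linearB -delta_linear thetaE //.
by rewrite (eq_delta rhoP wm) !deltaB !delta_delta !subr0 subrr.
Qed.

(** Induction on the degree [t]. For a cocycle [phi] of [R], the coefficients of [e v] lie in [m],
    so the homotopy formula makes [e (phi *: v)] a coboundary. The two preceding lemmas then write
    [phi *: v] as a coboundary modulo [B0], and [mu] carries this back to [phi]. *)
Lemma minimal_acyclic v (mu : {linear Q 0%N -> R^o}) :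
    (forall b, B0 b -> mu b = 0) -> mu v = 1 ->
    (forall nu : {linear Q 1%N -> R^o}, nu (e 0%N v) \in m) ->
  acy (T + sigma).
Proof.
move=> muB muv evm.
suff acyt t : (t <= T + sigma)%N -> acy t by apply: acyt.
elim: t => [_ l //|t IH tT l phi]; rewrite ltnS leq_eqVlt => /predU1P[->{l}|lt]; last exact: IH (ltnW tT) _ _ lt.
move=> _ dphi; have acyt := IH (ltnW tT).
have [n [lam [y [_ lamP]]]] := projQ 0.
have evE : e 0%N v = \sum_k lam k (e 0%N v) *: y k by apply/eqP; rewrite -subr_eq0 lamP.
pose theta u := \sum_k phi (lam k (e 0%N v) :: u) *: y k.
have phi_theta w : w \in word m t -> e 0%N (phi w *: v) = delta theta w.
  move=> wm; rewrite linearZ_LR {1}evE scaler_sumr delta_sum; apply: eq_bigr => k _.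
  rewrite delta_scalel scalerA; congr (_ *: _).
  have := delta_cons phi (lam k (e 0%N v)) w.
  by rewrite dphi ?word_cons ?evm // add0r mulrC.
have [||rho rhoP] := @lift_cocycle t 0 t (fun w => phi w *: v) theta acyt _ _ phi_theta.
- by [].
- exact: addn0.
have [||w wm|k kP] := @homology_acyclic 0 t (fun w => phi w *: v - delta rho w).
- by rewrite addn0.
- exact: rhoP.
- by rewrite deltaB delta_delta subr0 delta_scalel dphi // scale0r; apply: submod0 subB0.
exists (fun w => mu (rho w) + mu (k w)) => w wm.
have /muB := kP w wm; rewrite !linearB linearZ_LR muv => E.
by rewrite deltaD !delta_linear opprD addrA -[RHS]E [_ *: 1]mulr1.
Qed.

End Cocomplex.

Section SplitInduction.
Variables (R : comNzRingType) (m : idealr R) (T : nat).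
Hypothesis unit_m : forall x, x \notin m -> exists y, y * x = 1.

Lemma split_projective_mod (U V : lmodType R) (B : U -> Prop) (e : {linear U -> V})
    (r : {linear V -> U}) :
    (forall b, B b -> e b = 0) -> (forall v, B (r (e v) - v)) ->
  projective_mod (fun x : V => x = 0) ->
  projective_mod (fun x => exists y, e y = x).
Proof.
move=> eB rP [n [lam [q [_ lamP]]]].
have lam_lin l : linear (fun x => lam l (x - e (r x))).
  by move=> a x y; rewrite -linearP scalerBr addrACA -opprD -!linearP.
exists n, (fun l => mk_linear (lam_lin l)), q; split=> [l _ [y <-] /=|x].
  have /eB := rP y; rewrite linearB => /eqP; rewrite subr_eq0 => /eqP ->.
  by rewrite subrr linear0.
exists (r x) => /=; apply/eqP; rewrite eq_sym -subr_eq0 addrAC; apply/eqP.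
exact: lamP.
Qed.

(* As long as the complex starts with a split injection, its first term is dropped. *)
Lemma exists_minimal_start sigma (Q : nat -> lmodType R)
    (e : forall i, {linear Q i -> Q i.+1}) (B0 : Q 0%N -> Prop) :
    submod B0 -> (forall b, B0 b -> e 0%N b = 0) ->
    (forall i x, e i.+1 (e i x) = 0) ->
    projective_mod B0 -> (forall i, projective_mod (fun x : Q i.+1 => x = 0)) ->
    (forall i x, (i < sigma)%N -> e i x = 0 -> Bd e B0 i x) ->
    (forall i, (sigma <= i)%N -> acyclic m T (fun x => e i x = 0) (Bd e B0 i)) ->
    (exists x, e sigma x = 0 /\ ~ Bd e B0 sigma x) ->
  exists j, [/\ (j <= sigma)%N, projective_mod (Bd e B0 j) &
    acyclic m (T + (sigma - j)) (fun=> True) (fun z : R^o => z = 0)].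
Proof.
elim: sigma Q e B0 => [|sigma IH] Q e B0 subB eB ee projB projQ exactQ acyQ nz;
  have [[v [mu [muB muv evm]]]|[r rP]] := split_or_minimal unit_m subB eB projB.
- exists 0%N; split=> //; rewrite subn0.
  exact: minimal_acyclic subB ee projQ _ _ _ exactQ acyQ _ _ muB muv evm.
(* A split injection has no kernel modulo [B0], so the dropping stops at the latest at the nonzero
   homology in degree [sigma]. *)
- case: nz => x [ex0 nBx]; case: nBx.
  by have := submodN subB (rP x); rewrite opprB ex0 linear0 subr0.
- exists 0%N; split=> //; rewrite subn0.
  exact: minimal_acyclic subB ee projQ _ _ _ exactQ acyQ _ _ muB muv evm.
pose Q' i := Q i.+1; pose e' i : {linear Q' i -> Q' i.+1} := e i.+1.
pose B1 : Q' 0%N -> Prop := Bd e B0 1.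
have BdE i x : Bd e' B1 i x = Bd e B0 i.+1 x by case: i x.
have [||||||||j [jle projj acyj]] := IH Q' e' B1.
- exact (submod_Bd e subB 1).
- by move=> _ [y <-]; apply: ee.
- by move=> i x; apply: ee.
- exact: split_projective_mod eB rP (projQ 0%N).
- by move=> i; apply: projQ.
- by move=> i x lt ex; rewrite BdE; apply: exactQ.
- by move=> i si; have := acyQ i.+1 si; congr acyclic; apply/funext => x; rewrite BdE.
- by have [x [ex nBx]] := nz; exists x; rewrite BdE.
exists j.+1; split=> //; by have := projj; congr projective_mod; apply/funext => x; rewrite BdE.
Qed.

End SplitInduction.

Section Lifting.
Variable R : comNzRingType.
Implicit Types P A V : lmodType R.

(** [e] is not assumed onto: the fibre product of [e] and [f] maps onto [P], and a section of that
    map gives the lift. *)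
Lemma projective_lift P A V (f : {linear P -> V}) (e : {linear A -> V}) :
  projective P -> (forall x, exists a, e a = f x) ->
  exists h : {linear P -> A}, forall x, e (h x) = f x.
Proof.
move=> projP ef.
have d_lin : linear (fun u : A * P => e u.1 - f u.2).
  by move=> a u v; rewrite /= !(linearP e) !(linearP f) opprD addrACA scalerBr.
pose d := mk_linear d_lin; pose K := kernel d.
have fst_lin : linear (fun k : K => (val k).1) by [].
have snd_lin : linear (fun k : K => (val k).2) by [].
have [x|h hP] := projP K P (mk_linear snd_lin) idfun.
  have [a ea] := ef x.
  have Kax : (a, x) \in ker_pred d by rewrite unfold_in /= ea subrr.
  by exists (exist (fun u => u \in ker_pred d) (a, x) Kax : K).
exists (mk_linear fst_lin \o h) => x /=.
have := valP (h x); rewrite unfold_in /= subr_eq0 => /eqP ->.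
by congr (f _); apply: hP.
Qed.

End Lifting.

(** * Dimension shifting for Hom *)

Section HomVanishing.
Variable R : comNzRingType.
Variables (F : nat -> lmodType R) (d : forall n, {linear F n.+1 -> F n}) (g : nat).
Hypotheses (projF : forall n, projective (F n)) (dd0 : forall n x, d n (d n.+1 x) = 0).

Definition coboundary (V : lmodType R) (B : V -> Prop) n : {linear F n -> V} -> Prop :=
  match n with
  | 0 => fun phi => forall x, B (phi x)
  | n'.+1 => fun phi => exists psi : {linear F n' -> V}, forall x, B (phi x - psi (d n' x))
  end.
Arguments coboundary [V] B n _.

Hypothesis HomR : forall n (phi : {linear F n -> R^o}), (n < g)%N ->
  (forall x, phi (d n x) = 0) -> coboundary (fun z : R^o => z = 0) n phi.

Lemma projective_coboundary (V : lmodType R) (B : V -> Prop) n (phi : {linear F n -> V}) :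
    submod B -> projective_mod B -> (n < g)%N -> (forall x, B (phi (d n x))) ->
  coboundary B n phi.
Proof.
move=> subB [k [lam [q [lamB lamP]]]] ng phiP.
have lam_cob l : coboundary (fun z : R^o => z = 0) n (lam l \o phi).
  by apply: HomR => // x; apply: lamB.
case: n phi ng phiP lam_cob => [|n] phi ng phiP lam_cob /=.
  move=> x; rewrite -[phi x]subr0; have := lamP (phi x); rewrite big1 // => l _.
  by have /= -> := lam_cob l x; rewrite scale0r.
have {lam_cob} /choice[psi psiP] := lam_cob.
have psi_lin : linear (fun x => \sum_l psi l x *: q l).
  move=> a x y; rewrite scaler_sumr -big_split; apply: eq_bigr => l _.
  by rewrite linearP scalerDl scalerA.
exists (mk_linear psi_lin) => x /=; have := lamP (phi x); congr (B (_ - _)).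
apply: eq_bigr => l _; congr (_ *: _); apply/eqP; rewrite -subr_eq0.
exact/eqP/psiP.
Qed.

Variables (Q : nat -> lmodType R) (e : forall i, {linear Q i -> Q i.+1}).
Variable B0 : Q 0%N -> Prop.
Hypotheses (subB0 : submod B0) (eB0 : forall b, B0 b -> e 0%N b = 0).
Hypotheses (ee0 : forall i x, e i.+1 (e i x) = 0).
Hypotheses (projB0 : projective_mod B0).
Hypotheses (projQ : forall i, projective_mod (fun x : Q i.+1 => x = 0)).
Variable sigma : nat.
Hypothesis exactQ : forall i x, (i < sigma)%N -> e i x = 0 -> Bd e B0 i x.

(** With C_j = [Q j / Bd j], exactness makes C_j a submodule of [Q j.+1] with quotient C_(j+1). A
    cocycle [phi] into C_(j+1) satisfies [phi d = e alpha]; by induction [alpha] is [beta d] modulo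
    boundaries, so [phi - e beta] is a genuine cocycle into the projective module [Q j.+1]. *)
Lemma hom_cocycle j n (phi : {linear F n -> Q j}) : (j <= sigma)%N -> (n + j < g)%N ->
  (forall x, Bd e B0 j (phi (d n x))) -> coboundary (Bd e B0 j) n phi.
Proof.
elim: j n phi => [|j IH] n phi js njg phiP.
  by apply: projective_coboundary => //; rewrite addn0 in njg.
have [alpha alphaP] := projective_lift (f := phi \o d n) (e := e j) (@projF n.+1) phiP.
have [|||beta betaP] := IH n.+1 alpha.
- exact: ltnW.
- by rewrite addSnnS.
- by move=> x; apply: exactQ => //; rewrite alphaP /= dd0 linear0.
have phi'_lin : linear (fun x => phi x - e j (beta x)).
  by move=> a x y; rewrite (linearP phi) (linearP beta) (linearP (e j)) opprD addrACA scalerBr.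
have phi'P x : phi (d n x) - e j (beta (d n x)) = 0.
  have -> : phi (d n x) = e j (alpha x) by rewrite alphaP.
  by rewrite -linearB; apply: (e_Bd eB0 ee0 (betaP x)).
have := @projective_coboundary _ (fun v => v = 0) n (mk_linear phi'_lin)
  (submod_zero _) (projQ j) (leq_ltn_trans (leq_addr _ _) njg) phi'P.
case: n phi phiP alpha alphaP beta betaP phi'_lin phi'P njg => [|n] phi phiP alpha alphaP
  beta betaP phi'_lin phi'P njg /=.
  by move=> h x; exists (beta x); apply/eqP; rewrite eq_sym -subr_eq0 h.
move=> [psi psiP]; exists psi => x; exists (beta x).
by apply/eqP; rewrite eq_sym -subr_eq0 addrAC psiP.
Qed.

End HomVanishing.

(** * Regular sequences at a prime, with explicit denominators *)

Section LocalizedExactness.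
Variables (R : comNzRingType) (p : prime_idealr R).
Implicit Types (W : R^o -> Prop) (s t y : R).

Lemma prime_notin_mul s t : s \notin p -> t \notin p -> s * t \notin p.
Proof. by rewrite prime_idealrM negb_or => -> ->. Qed.

Lemma common_denominator n (P : 'I_n -> R -> Prop) :
    (forall l s t, P l s -> P l (t * s)) ->
    (forall l, exists s, s \notin p /\ P l s) ->
  exists s, s \notin p /\ forall l, P l s.
Proof.
move=> PM /choice[s sP]; exists (\prod_l s l); split=> [|l].
  elim/big_ind: _ => [|x y|l _]; rewrite ?idealr1 //; first exact: prime_notin_mul.
  by case: (sP l).
rewrite (bigD1 l) //= mulrC; apply: PM.
by case: (sP l).
Qed.

Definition saturated W : Prop := forall s v, s \notin p -> W (s * v) -> W v.

(* The contraction to [R] of the extension of [W + y R] to the localization at [p]. *)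
Definition sat_adjoin W y : R^o -> Prop :=
  fun v => exists s, s \notin p /\ adjoin W y (s * v : R^o).

Lemma submod_sat_adjoin W y : submod W -> submod (sat_adjoin W y).
Proof.
move=> /(submod_adjoin y) subW; split=> [|a u v [s [sp Ws]] [t [tp Wt]]].
  by exists 1; rewrite idealr1 mulr0; split=> //; apply: submod0 subW.
exists (s * t); split; first exact: prime_notin_mul.
have -> : s * t * (a *: u + v) = (t * a) *: (s * u : R^o) + s *: (t * v : R^o).
  by rewrite -[a *: u]/(a * u) -![_ *: (_ * _)]/(_ * (_ * _)); ring.
by apply: (submodD subW); apply: (submodZ subW).
Qed.

Lemma saturated_sat_adjoin W y : saturated (sat_adjoin W y).
Proof.
move=> s v sp [t [tp Wt]]; exists (t * s); split; first exact: prime_notin_mul.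
by rewrite -mulrA.
Qed.

(** For [W] contracted from the localization at [p], this is weak regularity of [ys] there modulo
    the extension of [W]. *)
Fixpoint loc_regular W (ys : seq R) : Prop :=
  if ys is y :: ys' then
    (forall v, W (y * v) -> W v) /\ loc_regular (sat_adjoin W y) ys'
  else True.

Variables (Q : nat -> lmodType R) (e : forall i, {linear Q i -> Q i.+1}).
Variable B0 : Q 0%N -> Prop.
Hypotheses (subB0 : submod B0) (eB0 : forall b, B0 b -> e 0%N b = 0).
Hypothesis ee0 : forall i x, e i.+1 (e i x) = 0.
Hypothesis projB0 : projective_mod B0.
Hypothesis projQ : forall i, projective_mod (fun x : Q i.+1 => x = 0).

Definition init_sub i : Q i -> Prop :=
  match i with
  | 0 => B0
  | i'.+1 => fun x => x = 0
  end.

(* For [Q i] projective modulo [init_sub i], this is [W Q_i + init_sub i]. *)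
Definition ext_sub W i (v : Q i) : Prop :=
  forall lam : {linear Q i -> R^o}, (forall b, init_sub b -> lam b = 0) -> W (lam v).

Lemma projective_init i : projective_mod (init_sub (i := i)).
Proof. by case: i => [|i]; [apply: projB0 | apply: projQ]. Qed.

Lemma submod_ext W i : submod W -> submod (ext_sub W (i := i)).
Proof.
move=> subW; split=> [lam _|a u v Wu Wv lam lamB].
  by rewrite linear0; apply: submod0 subW.
by rewrite linearP; apply: subW.2; [apply: Wu | apply: Wv].
Qed.

Lemma init_Bd i v : init_sub (i := i) v -> Bd e B0 i v.
Proof.
by case: i v => [|i] v //= ->; exists 0; rewrite linear0.
Qed.

Lemma e_ext W i v : submod W -> ext_sub W (i := i) v -> ext_sub W (e i v).
Proof.
move=> subW Wv lam _; apply: (Wv (lam \o e i)) => b.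
by case: i v Wv lam b => [|i] v Wv lam b /= => [/eB0 ->|->]; rewrite !linear0.
Qed.

Lemma ext_sat_adjoin W y i v : submod W -> ext_sub (sat_adjoin W y) (i := i) v ->
  exists s v', s \notin p /\ ext_sub W (s *: v - y *: v').
Proof.
move=> subW Wv; have [n [lam [q [lamB lamP]]]] := projective_init i.
have [||s [sp sP]] := @common_denominator n (fun l s => adjoin W y (s * lam l v : R^o)).
- move=> l s t; rewrite -mulrA; exact: (submodZ (submod_adjoin y subW)).
- by move=> l; apply: Wv; apply: lamB.
have /choice[c cP] : forall l, exists c, W (s * lam l v - y * c).
  by move=> l; have [b [c [Wb ->]]] := sP l; exists c; rewrite addrK.
exists s, (\sum_l c l *: q l); split=> // mu muB.
have -> : mu (s *: v - y *: \sum_l c l *: q l) =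
    s * mu (v - \sum_l lam l v *: q l) + \sum_l mu (q l) *: (s * lam l v - y * c l : R^o).
  rewrite !(linearB mu) !(linearZ_LR mu) !(linear_sum mu) [RHS]addrC mulrBr addrCA; congr (_ + _).
  rewrite scaler_sumr mulr_sumr -sumrN -[in RHS]sumrN -big_split; apply: eq_bigr => l _ /=.
  have muZ x : mu (x *: q l) = x * mu (q l) by rewrite linearZ_LR.
  rewrite !muZ -[y *: _]/(y * _) -[mu _ *: _]/(mu (q l) * _); ring.
rewrite muB // mulr0 add0r; apply: (submod_sum subW) => l.
by apply: (submodZ subW).
Qed.

(** Exactness at [Q i] of the complex reduced modulo [W] and localized at [p]; [mod_Bd] says that
    [z] becomes a boundary in that complex. *)
Definition exact_mod W i : Prop := forall w : Q i, ext_sub W (e i w) ->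
  exists s b, [/\ s \notin p, Bd e B0 i b & ext_sub W (s *: w - b)].

Definition mod_Bd W i (z : Q i) : Prop :=
  exists s b, [/\ s \notin p, Bd e B0 i b & ext_sub W (s *: z - b)].

Lemma ext_monot W y i v : submod W -> ext_sub W (i := i) v -> ext_sub (sat_adjoin W y) v.
Proof.
move=> subW Wv lam lamB; exists 1; rewrite idealr1 mul1r; split=> //.
by exists (lam v), 0; rewrite scaler0 addr0; split=> //; apply: Wv.
Qed.

Lemma ext_sat_mul W y i v : submod W -> ext_sub (sat_adjoin W y) (i := i) (y *: v).
Proof.
move=> subW lam _; exists 1; rewrite idealr1 mul1r; split=> //.
exists 0, (lam v); rewrite add0r linearZ_LR; split=> //.
exact: submod0 subW.
Qed.

Lemma ext_regular W y i v :
  (forall x, W (y * x) -> W x) -> ext_sub W (i := i) (y *: v) -> ext_sub W v.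
Proof. by move=> regy Wv lam lamB; apply: regy; have := Wv lam lamB; rewrite linearZ_LR. Qed.

(** If [e w = y v], then [y] cancels in [y (e v) = 0], so [v = e u] and [w - y u] is a cycle modulo
    [W]. Reduction by a regular element thus costs one degree of exactness. *)
Lemma exact_mod_adjoin W y i : submod W -> (forall v, W (y * v) -> W v) ->
  exact_mod W i.+1 -> exact_mod W i -> exact_mod (sat_adjoin W y) i.
Proof.
move=> subW regy exS ex w /(ext_sat_adjoin subW)[s [v [sp Wv]]].
have [|t [_ [tp [u <-] Wu]]] := exS v.
  apply: (ext_regular regy); have := submodN (submod_ext _ subW) (e_ext subW Wv).
  by rewrite (linearB (e i.+1)) !(linearZ_LR (e i.+1)) ee0 scaler0 sub0r opprK.
have [|r [b [rp Bb Wb]]] := ex ((t * s) *: w - y *: u).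
  have := submodD (submod_ext _ subW) (submodZ (submod_ext _ subW) t Wv)
    (submodZ (submod_ext _ subW) y Wu).
  rewrite !scalerBr !scalerA [t * y]mulrC subrKA.
  by rewrite linearB !linearZ_LR.
exists (r * (t * s)), b; split; rewrite ?prime_notin_mul //.
have -> : (r * (t * s)) *: w - b = (r *: ((t * s) *: w - y *: u) - b) + y *: (r *: u).
  by rewrite scalerBr !scalerA [r * y]mulrC addrAC subrK.
apply: (submodD (submod_ext _ (submod_sat_adjoin y subW))); first exact: ext_monot.
exact: ext_sat_mul.
Qed.

(* Writing [s y z = e w] modulo [W], where [y] is the first element of the sequence, [w] is
   an element of the same kind one degree lower, modulo [y]. *)
Lemma loc_regular_mod_Bd i W ys (z : Q i) :
    submod W -> saturated W -> (forall a, (a < i)%N -> exact_mod W a) ->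
    loc_regular W ys -> (i < size ys)%N ->
    (forall y, y \in ys -> mod_Bd W (y *: z)) -> mod_Bd W z.
Proof.
elim: i W ys z => [|i IH] W [|y ys] z subW satW exW //= [regy regys] lt zP.
  have [s [b [sp Bb Wb]]] := zP y (mem_head _ _).
  exists 1, 0; rewrite idealr1 scale1r subr0; split=> //; first exact: submod0 subB0.
  move=> lam lamB; apply/regy/(satW s) => //.
  by have := Wb lam lamB; rewrite linearB !(linearZ_LR lam) (lamB b) // subr0.
have [s [_ [sp [w <-] Ww]]] := zP y (mem_head _ _).
have [|||||y' y'ys|t [b [tp Bb Wb]]] := IH (sat_adjoin W y) ys w.
- exact: submod_sat_adjoin.
- exact: saturated_sat_adjoin.
- by move=> a ai; apply: exact_mod_adjoin => //; apply: exW => //; apply: ltnW.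
- by [].
- by [].
(* From [s y z = e w] and [t y' z = e u], the element [t y' w - s y u] is a cycle modulo [W]; so
   [y' w] is a boundary modulo [y]. *)
- have [t [_ [tp [u <-] Wu]]] := zP y' (mem_behead (s := y :: ys) y'ys).
  have [|r [b [rp Bb Wb]]] := exW i (ltnSn i) ((t * y') *: w - (s * y) *: u).
    have := submodB (submod_ext _ subW) (submodZ (submod_ext _ subW) (s * y) Wu)
      (submodZ (submod_ext _ subW) (t * y') Ww).
    rewrite !scalerBr !scalerA.
    rewrite opprB addrC [s * y * _]mulrC subrKA.
    by rewrite (linearB (e i)) !(linearZ_LR (e i)).
  exists (r * t), b; split; rewrite ?prime_notin_mul //.
  have -> : (r * t) *: (y' *: w) - b =
      (r *: ((t * y') *: w - (s * y) *: u) - b) + y *: ((r * s) *: u).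
    by rewrite scalerBr !scalerA !mulrA [y * r]mulrC [r * y * s]mulrAC addrAC subrK.
  apply: (submodD (submod_ext _ (submod_sat_adjoin y subW))); first exact: ext_monot.
  exact: ext_sat_mul.
(* Up to denominators [w] is a boundary plus [y v]. Hence [y z = e w = y (e v)] modulo [W], and [y]
   cancels. *)
have [r [v [rp Wv]]] := ext_sat_adjoin subW Wb.
exists (r * t * s), (e i v); split; rewrite ?prime_notin_mul //; first by exists v.
apply: (ext_regular regy).
have := submodD (submod_ext _ subW) (submodZ (submod_ext _ subW) (r * t) Ww) (e_ext subW Wv).
rewrite !(linearB (e i)) !(linearZ_LR (e i)) (linearB (e i)) (linearZ_LR (e i)) (e_Bd eB0 ee0 Bb) subr0.
by rewrite !scalerBr !scalerA subrKA; congr (ext_sub W (_ *: _ - _)); ring.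
Qed.

(** The kernel of the map from [R] to its localization at [p]. *)
Definition torsion : R^o -> Prop := fun v => exists s, s \notin p /\ s * v = 0.

Lemma submod_torsion : submod torsion.
Proof.
split=> [|a u v [s [sp su]] [t [tp tv]]]; first by exists 1; rewrite idealr1 mulr0.
exists (s * t); split; first exact: prime_notin_mul.
have -> : s * t * (a *: u + v) = a * t * (s * u) + s * (t * v).
  by rewrite -[a *: u]/(a * u); ring.
by rewrite su tv !mulr0 addr0.
Qed.

Lemma saturated_torsion : saturated torsion.
Proof.
move=> s v sp [t [tp tv]]; exists (t * s); rewrite -mulrA.
by split=> //; apply: prime_notin_mul.
Qed.

Lemma ext_torsion i (v : Q i) : ext_sub torsion v ->
  exists s, s \notin p /\ init_sub (s *: v).
Proof.
move=> Wv; have [n [lam [q [lamB lamP]]]] := projective_init i.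
have [||s [sp sP]] := @common_denominator n (fun l s => s * lam l v = 0).
- by move=> l s t lv; rewrite -mulrA lv mulr0.
- by move=> l; apply: Wv; apply: lamB.
exists s; split=> //; have := lamP (s *: v); rewrite big1 ?subr0 // => l _.
have -> : lam l (s *: v) = 0 by rewrite linearZ_LR; apply: sP.
exact: scale0r.
Qed.

Variable sigma : nat.
Hypothesis exactQ : forall i x, (i < sigma)%N -> e i x = 0 -> Bd e B0 i x.

(** Modulo [torsion] the condition [mod_Bd] means being a boundary after localization; a regular
    sequence with more than [sigma] terms killing the class of [z] would force this class to vanish
    locally. *)
Lemma loc_regular_size ys (z : Q sigma) :
    loc_regular torsion ys -> (forall y, y \in ys -> Bd e B0 sigma (y *: z)) ->
    (forall s, s \notin p -> ~ Bd e B0 sigma (s *: z)) ->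
  (size ys <= sigma)%N.
Proof.
move=> regys ysz sz; rewrite leqNgt; apply/negP => lt.
have subBd i := submod_Bd e subB0 i.
have ext0 i : ext_sub torsion (0 : Q i) by apply: submod0; apply/submod_ext/submod_torsion.
have [||a ai w Ww|//|//|y yys|s [b [sp Bb Wb]]] := @loc_regular_mod_Bd sigma torsion ys z.
- exact: submod_torsion.
- exact: saturated_torsion.
- have [s [sp sw]] := ext_torsion Ww; exists s, (s *: w); rewrite subrr; split=> //.
  by apply: exactQ => //; rewrite linearZ_LR.
- exists 1, (y *: z); rewrite idealr1 scale1r subrr; split=> //; exact: ysz.
have [t [tp /init_Bd tb]] := ext_torsion Wb.
apply: (sz (t * s)); first exact: prime_notin_mul.
rewrite -scalerA -[_ *: _](subrK (t *: b)) -scalerBr.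
by apply: (submodD (subBd sigma)) => //; apply: (submodZ (subBd sigma)).
Qed.

End LocalizedExactness.

(** * Quasi-projective resolutions and depth *)

Section RegularSequences.
Variables (R : comNzRingType) (M : lmodType R).
Implicit Types (B : M -> Prop) (s : seq R).

Lemma foldl_adjoin B s v : foldl (@adjoin R M) B s v <->
  exists b c, B b /\ v = b + \sum_(i < size s) s`_i *: c i.
Proof.
elim: s B => [|x s IH] B /=.
  split=> [Bv|[b [c [Bb ->]]]]; last by rewrite big_ord0 addr0.
  by exists v, (fun=> 0); rewrite big_ord0 addr0.
rewrite IH; split=> [[_ [c [[b [w [Bb ->]]] ->]]]|[b [c [Bb ->]]]].
  exists b, (fun i : 'I_(size s).+1 => if unlift ord0 i is Some j then c j else w).
  rewrite big_ord_recl unlift_none addrA; split=> //; congr (_ + _).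
  by apply: eq_bigr => i _; rewrite liftK.
exists (b + x *: c ord0), (fun i => c (lift ord0 i)); rewrite big_ord_recl addrA.
by split=> //; exists b, (c ord0).
Qed.

Lemma seq_mulP s v : v \in @seq_mul_pred R M s <-> foldl (@adjoin R M) (fun v => v = 0) s v.
Proof.
rewrite foldl_adjoin; split=> [/asboolP[c ->]|[_ [c [-> ->]]]].
  by exists 0, c; rewrite add0r.
apply/asboolP; exists (fun i => if insub i is Some j then c j else 0).
by rewrite add0r; apply: eq_bigr => i _; rewrite valK.
Qed.

Lemma regular_modP B s : regular_mod B s <->
  forall i, (i < size s)%N -> forall v,
    foldl (@adjoin R M) B (take i s) (s`_i *: v) -> foldl (@adjoin R M) B (take i s) v.
Proof.
elim: s B => [|x s IH] B; first by split=> // _ [].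
split=> [[regx /IH regs] [|i] /= lt v|regs]; [exact: regx | exact: regs | split].
  exact: (regs 0%N).
by apply/IH => i lt v; apply: (regs i.+1).
Qed.

Lemma quot_pi_linear (S : submodClosed M) : linear (quot_pi S).
Proof. by move=> a x y; rewrite quot_piD quot_pi_scale. Qed.

Lemma quot_mod_eq0 (S : submodClosed M) v : quot_pi S v = 0 <-> v \in S.
Proof.
have -> : 0 = quot_pi S 0.
  by apply: (addrI (quot_pi S 0)); rewrite -quot_piD !addr0.
by rewrite quot_piP subr0.
Qed.

Lemma regular_sequence_mod s :
  (forall i, (i < size s)%N ->
     forall x : quot_mod (@seq_mul_pred R M (take i s)), s`_i *: x = 0 -> x = 0) <->
  regular_mod (fun v : M => v = 0) s.
Proof.
rewrite regular_modP; split=> reg i lt => [v /seq_mulP sv|x].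
  have /quot_mod_eq0/seq_mulP// : quot_pi (@seq_mul_pred R M (take i s)) v = 0.
  by apply: reg => //; rewrite -[_ *: _]quot_pi_scale; apply/quot_mod_eq0.
rewrite -(quot_reprK x) -[_ *: _]quot_pi_scale => /quot_mod_eq0/seq_mulP sx.
exact/quot_mod_eq0/seq_mulP/reg.
Qed.

End RegularSequences.

Lemma regular_sequence_ring (R : comNzRingType) (m : idealr R) (s : seq R) :
  all [in m] s -> regular_mod (fun v : R^o => v = 0) s -> regular_sequence R^o s.
Proof.
move=> sm /regular_sequence_mod reg; split=> //.
exists (quot_pi _ (1 : R^o)); apply/eqP => /quot_mod_eq0/asboolP[c E].
have := idealr1 m; rewrite E rpred_sum // => i _.
by rewrite [_ *: _]mulrC idealMr // (allP sm) ?mem_nth.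
Qed.

Section Homology.
Variable R : comNzRingType.

Lemma acyclic_ffun (m : {pred R}) t n (M : lmodType R) :
  acyclic m t (fun=> True) (fun v : M => v = 0) ->
  acyclic m t (fun=> True) (fun v : {ffun 'I_n -> M} => v = 0).
Proof.
move=> acyM l phi lt _ phi0.
have ev_lin i : linear (fun v : {ffun 'I_n -> M} => v i) by move=> a u v; rewrite !ffunE.
have /choice[psi psiP] : forall i, exists psi : seq R -> M, forall w, w \in word m l ->
    phi w i - delta psi w = 0.
  move=> i; apply: (acyM l (fun w => phi w i)) => // w wm.
  by have /= -> := delta_linear (mk_linear (ev_lin i)) phi w; rewrite phi0 // ffunE.
exists (fun w => [ffun i => psi i w]) => w wm; apply/ffunP => i; rewrite !ffunE.
have /= <- := delta_linear (mk_linear (ev_lin i)) (fun w => [ffun i => psi i w]) w.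
rewrite -[RHS](psiP i w wm); congr (_ - delta _ w).
by apply/funext => u; rewrite ffunE.
Qed.

Lemma acyclic_subquotient (m : {pred R}) t (V V' W : lmodType R) (d : {linear V -> V'})
    (g : {linear kernel d -> W}) (B : V -> Prop) :
    (forall y, exists k, g k = y) -> (forall k, g k = 0 -> B (val k)) ->
    (forall k, B (val k) -> g k = 0) ->
  acyclic m t (fun=> True) (fun v : W => v = 0) ->
  acyclic m t (fun v => d v = 0) B.
Proof.
move=> g_onto gB Bg acyW l phi lt dphi Bphi.
have /choice[k kP] : forall w, exists k : kernel d, w \in word m l -> val k = phi w.
  move=> w; have [wm|] := boolP (w \in word m l); last by exists 0.
  have kw : phi w \in ker_pred d by rewrite unfold_in dphi.
  by exists (exist (fun v => v \in ker_pred d) (phi w) kw).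
have val_lin : linear (fun k : kernel d => val k) by [].
have val_delta (h : seq R -> kernel d) w : val (delta h w) = delta (fun u => val (h u)) w.
  by have /= -> := delta_linear (mk_linear val_lin) h w.
have [|//|w wm|psi psiP] := acyW l (fun w => g (k w)); first exact: lt.
  rewrite delta_linear; apply: Bg; rewrite val_delta.
  by rewrite (eq_delta kP wm); apply: Bphi.
have /choice[h hP] : forall w, exists x, g x = psi w by move=> w; apply: g_onto.
exists (fun w => val (h w)) => w wm; rewrite -kP // -val_delta -raddfB; apply: gB.
rewrite linearB -delta_linear -[RHS](psiP w wm); congr (_ - delta _ w).
by apply/funext => u; apply: hP.
Qed.

(** The neighbouring degrees are variables bound by equations, so that the lemma applies to indices
    equal to [i + 1] and [i - 1] only up to proof. *)
Lemma homology_iso (X : complex R) (i a b : int) (N : lmodType R) :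
    a = i + 1 -> b = i - 1 -> isomorphic (homology X i) N ->
  exists g : {linear kernel (cdiff X i b) -> N}, (forall y, exists k, g k = y) /\
    forall k, g k = 0 <-> exists y, cdiff X a i y = val k.
Proof.
move=> -> -> [f [h fK hK]].
pose S := boundary_pred (cdiff X (i + 1) i) (g := cdiff X i (i - 1)).
exists (f \o mk_linear (quot_pi_linear S)); split=> [y|k] /=.
  by exists (quot_repr (h y)); rewrite quot_reprK hK.
split=> [fk|[y yk]].
  have /quot_mod_eq0/asboolP// : quot_pi S k = 0.
  by apply: (can_inj fK); rewrite fk linear0.
have /quot_mod_eq0 -> : k \in S by apply/asboolP; exists y.
by rewrite linear0.
Qed.

End Homology.

(** * Suprema and infima of extended integers *)

Section ExtendedIntegers.
Local Open Scope classical_set_scope.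
Local Open Scope ereal_scope.
Implicit Types A : set (\bar int).

(** [supremum] chooses among the least upper bounds, so its value says something once one exists. A
    set of integers bounded by [n] has its maximum at the least distance [k] below [n]. *)
Lemma supremums_neq0 A : A !=set0 -> supremums A !=set0.
Proof.
move=> [a0 Aa0]; have [Aoo|nAoo] := pselect (A +oo).
  by exists +oo; split=> [x _|x]; [exact: leey | apply].
have [[z0 Az0]|nfin] := pselect (exists z : int, A z%:E); last first.
  exists -oo; split=> [[z Az|//|//]|x _]; last exact: leNye.
  by case: nfin; exists z.
have [[n nP]|unb] := pselect (exists n : nat, forall z : int, A z%:E -> (z <= n%:Z)%R); last first.
  exists +oo; split=> [x _|x xub]; first exact: leey.
  case: x xub => [x xub|//|xub]; last by have := xub _ Az0.
  case: unb; exists `|x|%N => z Az; have := xub _ Az; rewrite lee_fin; lia.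
have exk : exists k : nat, `[< A ((n%:Z - k%:Z)%R)%:E >].
  exists `|(n%:Z - z0)%R|%N; apply/asboolP.
  have -> : (n%:Z - `|(n%:Z - z0)%R|%N%:Z = z0)%R by have := nP _ Az0; lia.
  exact: Az0.
case: (ex_minnP exk) => k /asboolP Ak kmin.
exists (n%:Z - k%:Z)%R%:E; split=> [[z Az|//|_]|x]; [|exact: leNye|exact].
rewrite lee_fin; have := nP _ Az => zn.
suff : (k <= `|(n%:Z - z)%R|)%N by lia.
apply: kmin; apply/asboolP.
by have -> : (n%:Z - `|(n%:Z - z)%R|%N%:Z = z)%R by lia.
Qed.

Lemma infimums_neq0 A : A !=set0 -> infimums A !=set0.
Proof.
move=> [a Aa]; have [|s [sub slub]] := @supremums_neq0 [set - x | x in A].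
  by exists (- a), a.
exists (- s); split=> [x Ax|x xlb].
  by rewrite leeNl; apply: sub; exists x.
rewrite leeNr; apply: slub => _ [y Ay <-]; rewrite leeN2; exact: xlb.
Qed.

Lemma supremumE x0 A s : supremums A s -> A !=set0 -> supremum x0 A = s.
Proof.
move=> sA A0; apply: (@is_subset1_supremums _ _ A) => //.
rewrite /supremum; case: ifPn => [/eqP A0'|_]; last exact: xgetI sA.
by case: A0; rewrite A0'.
Qed.

Lemma infimumE x0 A s : infimums A s -> A !=set0 -> infimum x0 A = s.
Proof.
move=> sA A0; apply: (@is_subset1_infimums _ _ A) => //.
rewrite /infimum; case: ifPn => [/eqP A0'|_]; last exact: xgetI sA.
by case: A0; rewrite A0'.
Qed.

Lemma le_supremum x0 A x : A x -> x <= supremum x0 A.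
Proof. by move=> Ax; apply: ge_supremum_Nmem => //; apply: supremums_neq0; exists x. Qed.

Lemma ge_infimum x0 A x : A x -> infimum x0 A <= x.
Proof. by move=> Ax; apply: le_infimum_Nmem => //; apply: infimums_neq0; exists x. Qed.

Lemma supremum_le x0 A x : A !=set0 -> (forall y, A y -> y <= x) -> supremum x0 A <= x.
Proof.
move=> A0 Ax; have [s sA] := supremums_neq0 A0.
by rewrite (supremumE x0 sA A0); apply: sA.2.
Qed.

Lemma infimum_nat (N : set nat) :
  infimum +oo [set n%:Z%:E | n in N] = +oo \/
  exists n, [/\ N n, infimum +oo [set n%:Z%:E | n in N] = n%:Z%:E &
                forall k, N k -> (n <= k)%N].
Proof.
have [[n0 Nn0]|N0] := pselect (exists n, N n); last first.
  left; rewrite (_ : [set _ | _ in N] = set0) /infimum ?eqxx //.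
  by apply/seteqP; split=> // x [n Nn _]; case: N0; exists n.
right; have exn : exists n, `[< N n >] by exists n0; apply/asboolP.
case: (ex_minnP exn) => n /asboolP Nn nmin.
have minN k : N k -> (n <= k)%N by move=> Nk; apply/nmin/asboolP.
exists n; split=> //; apply: infimumE; last by exists n%:Z%:E, n.
split=> [_ [k /minN nk <-]|x xlb]; first by rewrite lee_fin lez_nat.
by apply: xlb; exists n.
Qed.

Lemma supremum_nat (N : set nat) : N !=set0 ->
  let s := supremum -oo [set n%:Z%:E | n in N] in
  (s = +oo /\ forall n, exists k, N k /\ (n <= k)%N) \/
  (exists n, [/\ N n, s = n%:Z%:E & forall k, N k -> (k <= n)%N]).
Proof.
move=> [n0 Nn0] s.
have le_s k : N k -> k%:Z%:E <= s by move=> Nk; apply: le_supremum; exists k.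
have s_le x : (forall k, N k -> k%:Z%:E <= x) -> s <= x.
  move=> kx; apply: supremum_le; first by exists n0%:Z%:E, n0.
  by move=> _ [k Nk <-]; apply: kx.
have [[b bP]|unb] := pselect (exists b, forall k, N k -> (k <= b)%N); last first.
  have cof n : exists k, N k /\ (n <= k)%N.
    apply: contrapT => nok; apply: unb; exists n => k Nk; apply: contrapT => kn.
    by apply: nok; exists k; split=> //; apply: ltnW; rewrite ltnNge; apply/negP.
  left; split=> //; have := le_s _ Nn0.
  case E : s => [x| |] // _; have [k [Nk xk]] := cof `|x|%N.+1.
  by have := le_s _ Nk; rewrite E lee_fin; lia.
right; have exn : exists n, `[< N n >] by exists n0; apply/asboolP.
have bb n : `[< N n >] -> (n <= b)%N by move/asboolP/bP.
case: (ex_maxnP exn bb) => n /asboolP Nn nmax.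
have maxN k : N k -> (k <= n)%N by move=> Nk; apply/nmax/asboolP.
exists n; split=> //; apply/eqP; rewrite eq_le le_s // andbT.
by apply: s_le => k /maxN kn; rewrite lee_fin lez_nat.
Qed.

End ExtendedIntegers.

(** * From finite qpd to a complex numbered from the top *)

Section QuasiProjectiveResolution.
Variable R : comNzRingType.
Local Open Scope classical_set_scope.

Lemma zero_mod_eq0 (V : lmodType R) : ~ nonzero_mod V -> forall x : V, x = 0.
Proof. by move=> V0 x; apply/eqP/negPn/negP => x0; apply: V0; exists x. Qed.

Lemma bounded_above (P : complex R) : bounded_below P -> bounded P ->
  exists n : int, forall i, (n < i)%R -> forall x : P i, x = 0.
Proof.
rewrite /bounded_below /bounded => lb ub.
have [//|unb] := pselect (exists n : int, forall i, (n < i)%R -> forall x : P i, x = 0).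
have nz n : exists i, (n < i)%R /\ nonzero_mod (P i).
  apply: contrapT => noi; apply: unb; exists n => i ni x.
  by apply: zero_mod_eq0 => Pi; apply: noi; exists i.
have csup_oo : csup P = +oo%E.
  have le_csup i : nonzero_mod (P i) -> (i%:E <= csup P)%E.
    by move=> Pi; apply: le_supremum; exists i.
  case E : (csup P) le_csup => [x| |] // le_csup; last by have [i [_ /le_csup]] := nz 0.
  by have [i [xi /le_csup]] := nz x; rewrite lee_fin leNgt xi.
have [i [_ Pi]] := nz 0.
have : (cinf P <= i%:E)%E by apply: ge_infimum; exists i.
by move: lb ub; rewrite csup_oo; case: (cinf P).
Qed.

Lemma below_cinf (P : complex R) i : ~ (cinf P <= i%:E)%E -> forall x : P i, x = 0.
Proof. by move=> lt; apply: zero_mod_eq0 => Pi; apply: lt; apply: ge_infimum; exists i. Qed.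

Lemma qpd_cocomplex (M : lmodType R) : nonzero_mod M -> (qpd M < +oo)%E ->
  exists (Q : nat -> lmodType R) (e : forall i, {linear Q i -> Q i.+1}) (a : nat -> nat),
    [/\ forall i x, e i.+1 (e i x) = 0,
        forall i, projective_mod (fun x : Q i => x = 0),
        forall i, exists g : {linear kernel (e i) -> {ffun 'I_(a i) -> M}},
          (forall y, exists k, g k = y) /\
          forall k, g k = 0 <-> Bd e (fun x => x = 0) i (val k) &
        exists i, a i <> 0%N].
Proof.
move=> [x0 x0_neq0] qfin.
have [P [[lbP projP [a [aP [i0 i0inf ai0]]]] bP]] : exists P : complex R,
    quasi_projective_resolution P M /\ bounded P.
  apply: contrapT => noP; move: qfin; rewrite /qpd (_ : [set d | _] = set0); last first.
    by apply/seteqP; split=> // d [P [qP bP _]]; apply: noP; exists P.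
  by rewrite /infimum eqxx ltxx.
have [n nP] := bounded_above lbP bP.
pose Q i := P (n - i%:Z).
pose e i : {linear Q i -> Q i.+1} := cdiff P (n - i%:Z) (n - i.+1%:Z).
(* Below [inf P] the terms vanish and the resolution prescribes no exponent; 0 is used there. *)
pose b i := if pselect (cinf P <= (n - i%:Z)%:E)%E is left _ then a (n - i%:Z) else 0%N.
have BdE i (v : Q i) : Bd e (fun x => x = 0) i v <->
    exists y, cdiff P (n - i%:Z + 1) (n - i%:Z) y = v.
  case: i v => [|i] v /=; last by have -> : n - i.+1%:Z + 1 = n - i%:Z by lia.
  split=> [->|[y <-]]; first by exists 0; rewrite linear0.
  by rewrite (nP _ _ y) ?linear0 //; lia.
exists Q, e, b; split=> [i x|i|i|].
- exact: cdiff_sq0.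
- by have [fgP pP] := projP (n - i%:Z); apply: fg_projective_mod.
- have [ile|ilt] := pselect (cinf P <= (n - i%:Z)%:E)%E; last first.
    have bi0 : b i = 0%N by rewrite /b; case: pselect.
    rewrite bi0; exists \0; split=> [y|k].
      by exists 0; apply/ffunP; case.
    split=> // _; have -> : val k = 0 by apply: below_cinf.
    by apply: submod0; apply: submod_Bd; apply: submod_zero.
  have bia : b i = a (n - i%:Z) by rewrite /b; case: pselect.
  rewrite bia; have [||g [g_onto gP]] := homology_iso (a := n - i%:Z + 1) (b := n - i.+1%:Z) _ _ (aP _ ile).
  - by [].
  - by lia.
  by exists g; split=> // k; rewrite gP -BdE.
have lt_n : (i0 <= n)%R.
  rewrite leNgt; apply/negP => /nP Pi0.
  have [g [g_onto _]] := homology_iso erefl erefl (aP i0 i0inf).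
  have [k gk] := g_onto [ffun=> x0].
  have k0 : k = 0 by apply: val_inj; rewrite /= [RHS]Pi0; apply: Pi0.
  move: ai0 g g_onto gk; case: (a i0) => // m _ g _; rewrite k0 linear0 => /ffunP/(_ ord0).
  by rewrite !ffunE => x0E; rewrite -x0E eqxx in x0_neq0.
exists `|n - i0|%N; have ni0 : n - `|n - i0|%N%:Z = i0 by lia.
by rewrite /b ni0; case: pselect.
Qed.

End QuasiProjectiveResolution.

(** * Lower bounds for the depth of R *)

Section DepthBounds.
Variables (R : comNzRingType) (m : idealr R) (M : lmodType R).
Hypotheses (noethR : noetherian R) (unit_m : forall x, x \notin m -> exists y, y * x = 1).
Hypotheses (nzM : nonzero_mod M) (qpdM : (qpd M < +oo)%E).
Variable s : seq R.
Hypotheses (sm : all [in m] s) (regs : regular_mod (fun v : M => v = 0) s).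

(** The common input of the bounds below. [sigma] counts the steps from the first remaining term to
    the highest nonzero homology, which [g] identifies with a positive power of [M]. *)
Lemma qpd_minimal_start :
  exists (Q : nat -> lmodType R) (e : forall i, {linear Q i -> Q i.+1})
      (B0 : Q 0%N -> Prop) (sigma n : nat) (g : {linear kernel (e sigma) -> {ffun 'I_n.+1 -> M}}),
    [/\ submod B0, forall b, B0 b -> e 0%N b = 0 & forall i x, e i.+1 (e i x) = 0] /\
    [/\ projective_mod B0,
        forall i, projective_mod (fun x : Q i.+1 => x = 0) &
        forall i x, (i < sigma)%N -> e i x = 0 -> Bd e B0 i x] /\
    [/\ forall y, exists k, g k = y,
        forall k, g k = 0 <-> Bd e B0 sigma (val k) &
        acyclic m (size s + sigma) (fun=> True) (fun z : R^o => z = 0)].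
Proof.
have [Q [e [a [ee projQ gP [i0 ai0]]]]] := qpd_cocomplex nzM qpdM.
have exa : exists i, a i != 0%N by exists i0; apply/eqP.
(* With degrees counted from the top, the least index with a nonzero exponent is the highest
   homology. *)
have [sigma asigma sigma_min] := ex_minnP exa.
have acyM := regular_acyclic (submod_zero M) sm regs.
pose Z (x : Q 0%N) := x = 0.
have subZ : submod Z := submod_zero (Q 0%N).
have eZ b : Z b -> e 0%N b = 0 by move=> ->; rewrite linear0.
have exactQ i x : (i < sigma)%N -> e i x = 0 -> Bd e Z i x.
  move=> lt ex; have [g [_ gB]] := gP i.
  have kx : x \in ker_pred (e i) by rewrite unfold_in ex.
  apply/(gB (exist (fun v => v \in ker_pred (e i)) x kx)); apply/ffunP => l.
  suff ai : a i = 0%N by have := leq_trans (ltn_ord l) (eq_leq ai).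
  by apply/eqP; apply: contraLR lt => ai; rewrite -leqNgt; apply: sigma_min.
have acyQ i : (sigma <= i)%N -> acyclic m (size s) (fun x => e i x = 0) (Bd e Z i).
  move=> _; have [g [g_onto gB]] := gP i.
  by apply: (acyclic_subquotient g_onto (fun k => (gB k).1) (fun k => (gB k).2)); apply: acyclic_ffun.
have [x0 x0_neq0] := nzM.
have [|j [jle projj acyj]] := exists_minimal_start unit_m subZ eZ ee (projQ 0%N)
    (fun i => projQ i.+1) exactQ acyQ.
  have [g [g_onto gB]] := gP sigma; have [k gk] := g_onto [ffun=> x0].
  exists (val k); split; first by have := valP k; rewrite unfold_in => /eqP.
  move/gB; rewrite gk; case: (a sigma) asigma {g g_onto gB k gk} => // n _ /ffunP/(_ ord0).
  by rewrite !ffunE => x00; rewrite x00 eqxx in x0_neq0.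
(* Writing [sigma] as [k + j] makes [Q' k] convertible to [Q (k + j)] and avoids a transport. *)
have [k sigmaE] : exists k, sigma = (k + j)%N by exists (sigma - j)%N; rewrite subnK.
rewrite sigmaE addnK in acyj.
have [n an] : exists n, a (k + j)%N = n.+1.
  by move: asigma; rewrite sigmaE; case: (a _) => // n _; exists n.
have := gP (k + j)%N; rewrite an => -[g [g_onto gB]].
pose Q' i := Q (i + j)%N; pose e' i : {linear Q' i -> Q' i.+1} := e (i + j)%N.
have BdE i x : Bd e' (Bd e Z j) i x = Bd e Z (i + j)%N x by case: i x.
exists Q', e', (Bd e Z j), k, n, g; split; last split.
- split=> [|b Bb|i x]; [exact (submod_Bd e subZ j) | exact (e_Bd eZ ee Bb) | exact: ee].
- split=> // [i|i x lt ex]; first exact: projQ.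
  by rewrite BdE; apply: exactQ => //; rewrite sigmaE ltn_add2r.
- by split=> // l; rewrite BdE; apply: gB.
Qed.

Lemma regular_sequence_acyclic t :
  acyclic m t (fun=> True) (fun z : R^o => z = 0) ->
  exists u, [/\ size u = t, all [in m] u & regular_sequence R^o u].
Proof.
move=> /(acyclic_regular noethR (submod_zero _))[u [su um regu]].
by exists u; split=> //; apply: (regular_sequence_ring um regu).
Qed.

(** This serves the case of grade 0, where [0 <= sigma] is enough and the vanishing of Ext gives no
    information. *)
Lemma depth_bound : exists u, [/\ size u = size s, all [in m] u & regular_sequence R^o u].
Proof.
have [Q [e [B0 [sigma [n [h [_ [_ [_ _ acy]]]]]]]]] := qpd_minimal_start.
by apply: regular_sequence_acyclic; apply: acyclic_leq acy; apply: leq_addr.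
Qed.

(* If Ext^i(M, R) = 0 for i < g, then g is at most the length [sigma] of the resolution
   of the cokernel C = Q_sigma / Bd_sigma, since M embeds in C. *)
Lemma depth_grade_bound (F : nat -> lmodType R) (d : forall n, {linear F n.+1 -> F n})
    (pi : {linear F 0%N -> M}) (g : nat) :
    (forall n, projective (F n)) -> (forall n x, d n (d n.+1 x) = 0) ->
    (forall x, exists y, pi y = x) -> (forall x, pi (d 0%N x) = 0) ->
    (forall n (phi : {linear F n -> R^o}), (n < g)%N ->
      (forall x, phi (d n x) = 0) -> coboundary d (fun z : R^o => z = 0) (n := n) phi) ->
  exists u, [/\ size u = (size s + g)%N, all [in m] u & regular_sequence R^o u].
Proof.
move=> projF dd pi_onto pid HomR.
have [Q [e [B0 [sigma [n [h [[subB eB ee] [[projB projQ exactQ] [h_onto hB acy]]]]]]]]] :=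
  qpd_minimal_start.
apply: regular_sequence_acyclic; apply: acyclic_leq acy; rewrite leq_add2l leqNgt.
apply/negP => lt.
(* The diagonal embeds [M] in the homology at [sigma]. Lifted to [F 0], it is a degree 0 cocycle
   with values in [Q sigma / Bd sigma], which has to vanish if [sigma < g]. *)
have diag_lin : linear (fun v : M => [ffun=> v] : {ffun 'I_n.+1 -> M}).
  by move=> a u v; apply/ffunP => i; rewrite !ffunE.
have [x|f fP] := @projective_lift _ _ _ _ (mk_linear diag_lin \o pi) h (projF 0%N).
  exact: h_onto.
have val_lin : linear (fun k : kernel (e sigma) => val k) by [].
have Bx : forall x, Bd e B0 sigma (val (f x)).
  apply: (hom_cocycle projF dd HomR subB eB ee projB projQ exactQ
    (n := 0%N) (phi := mk_linear val_lin \o f) (leqnn sigma) lt) => x.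
  apply/hB; rewrite fP /= pid.
  by apply/ffunP => i; rewrite !ffunE.
have [x0 x0_neq0] := nzM; have [y piy] := pi_onto x0.
have /hB := Bx y; rewrite fP /= piy => /ffunP/(_ ord0).
by rewrite !ffunE => x00; rewrite x00 eqxx in x0_neq0.
Qed.

(** An element of [M] with annihilator [p], taken on the diagonal, gives a class modulo [Bd] with
    annihilator [p]; [loc_regular_size] then bounds [size ys] by [sigma]. *)
Lemma depth_localization_bound (p : prime_idealr R) (ys : seq R) :
    associated_prime M p -> all [in p] ys -> loc_regular p (torsion p) ys ->
  exists u, [/\ size u = (size s + size ys)%N, all [in m] u & regular_sequence R^o u].
Proof.
move=> [z0 z0P] ysp regys.
have [Q [e [B0 [sigma [n [h [[subB eB ee] [[projB projQ exactQ] [h_onto hB acy]]]]]]]]] :=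
  qpd_minimal_start.
have [k hk] := h_onto [ffun=> z0].
have BdE a : Bd e B0 sigma (a *: val k) <-> a \in p.
  rewrite -[a *: val k]/(val (a *: k)) -hB linearZ_LR hk z0P.
  split=> [/ffunP/(_ ord0)|az]; first by rewrite !ffunE.
  by apply/ffunP => i; rewrite !ffunE.
apply: regular_sequence_acyclic; apply: acyclic_leq acy; rewrite leq_add2l.
apply: (loc_regular_size subB eB ee projB projQ exactQ regys (z := val k)).
  by move=> y /(allP ysp) yp; apply/BdE.
by move=> a ap /BdE; apply/negP.
Qed.

End DepthBounds.

Section HomComplexHomology.
Variables (R : comNzRingType) (P : complex R) (N : lmodType R).

Lemma hom_mod_pred (U : lmodType R) (f : {linear U -> N}) : (f : U -> N) \in @linear_pred R U N.
Proof. by apply/asboolP; apply: linearP. Qed.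

Definition to_hom (U : lmodType R) (f : {linear U -> N}) : hom_mod U N :=
  exist (fun f : U -> N => f \in @linear_pred R U N) f (hom_mod_pred f).

Lemma hom_homology_zero (i n a b : int) :
    n = - i -> a = - (i - 1) -> b = - (i + 1) ->
    ~ nonzero_mod (homology (hom_complex P N) i) ->
  forall phi : {linear P n -> N}, (forall x, phi (cdiff P a n x) = 0) ->
  exists psi : {linear P b -> N}, forall x, phi x = psi (cdiff P n b x).
Proof.
move=> -> -> -> H0 phi phid.
have k_ker : to_hom phi \in ker_pred (cdiff (hom_complex P N) i (i - 1)).
  by rewrite unfold_in; apply/eqP/val_inj/funext => x; apply: phid.
pose k : kernel (cdiff (hom_complex P N) i (i - 1)) :=
  exist (fun f => f \in ker_pred (cdiff (hom_complex P N) i (i - 1))) _ k_ker.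
pose S := boundary_pred (cdiff (hom_complex P N) (i + 1) i) (g := cdiff (hom_complex P N) i (i - 1)).
have /quot_mod_eq0/asboolP[psi psiP] := zero_mod_eq0 H0 (quot_pi S k).
exists (mk_linear (hom_mod_linear psi)) => x /=.
by move/(congr1 (fun f : hom_mod _ _ => val f x)): psiP.
Qed.

Lemma hom_homology_nonzero (i n : int) : n = - i ->
  nonzero_mod (homology (hom_complex P N) i) -> exists (phi : {linear P n -> N}) x, phi x <> 0.
Proof.
move=> -> [y /eqP y0]; apply: contrapT => noPhi; apply: y0.
rewrite -(quot_reprK y); apply/quot_mod_eq0.
have -> : quot_repr y = 0; last exact: rpred0.
apply/val_inj/val_inj/funext => x; apply: contrapT => yx; apply: noPhi.
by exists (mk_linear (hom_mod_linear (val (quot_repr y)))), x.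
Qed.

End HomComplexHomology.

Section Grade.
Variables (R : comNzRingType) (M : lmodType R).

(* When no projective resolution exists, [proj_res M] is [M] in every degree with zero
   differentials, so that every Ext^i(M, R) is then Hom(M, R). *)
Lemma grade_projective_resolution (g : nat) : (0 < g)%N ->
    (forall i, (i < g)%N -> ~ nonzero_mod (Ext i M R^o)) -> nonzero_mod (Ext g M R^o) ->
  projective_resolution (proj_res M) M.
Proof.
rewrite /Ext /proj_res => g0; case: pselect => [ex|no_res]; first by move=> _ _; exact: svalP (cid ex).
move=> /(_ 0%N g0) ext0 /(hom_homology_nonzero (n := g%:Z))[|phi [x phix]]; first by rewrite opprK.
case: phix; have [||||psi ->] := hom_homology_zero (n := 0) (a := 1) (b := -1) _ _ _ ext0 (phi := phi).
- by [].
- by [].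
- by [].
- by move=> y; apply: linear0.
- exact: linear0.
Qed.

Lemma proj_res_coboundary (g : nat) :
    (forall i x, (i < 0)%R -> x = 0 :> proj_res M i) ->
    (forall i, (i < g)%N -> ~ nonzero_mod (Ext i M R^o)) ->
  forall n (phi : {linear proj_res M n%:Z -> R^o}), (n < g)%N ->
    (forall x, phi (cdiff (proj_res M) n.+1 n x) = 0) ->
  coboundary (fun n => cdiff (proj_res M) n.+1 n) (fun z : R^o => z = 0) (n := n) phi.
Proof.
move=> neg0 ext0 n phi ng phid.
case: n phi ng phid => [|n] phi ng phid /=.
  have [||||psi psiP] := hom_homology_zero (n := 0) (a := 1) (b := -1) _ _ _ (ext0 0%N ng) (phi := phi).
  - by [].
  - by [].
  - by [].
  - exact: phid.
  by move=> x; rewrite psiP -[RHS](linear0 psi); congr (psi _); apply: neg0.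
have [||||psi psiP] := hom_homology_zero (n := n.+1%:Z) (a := n.+2%:Z) (b := n%:Z) _ _ _ (ext0 _ ng) (phi := phi).
- by rewrite opprK.
- by lia.
- by lia.
- exact: phid.
by exists psi => x; rewrite psiP subrr.
Qed.

End Grade.

(** * Depth of the localization *)

Section LocalizationRegular.
Variables (R : comNzRingType) (p : prime_idealr R).
Let L := localization p.

Definition to_loc (v : R) : L := cls (v, one_denom p).

Lemma to_locM u v : to_loc (u * v) = to_loc u * to_loc v.
Proof.
rewrite /to_loc -[RHS]/(Localization.mul _ _) mul_cls; apply/clsP; exists (one_denom p).
by rewrite /=; ring.
Qed.

Lemma to_locB u v : to_loc (u - v) = to_loc u - to_loc v.
Proof.
rewrite /to_loc -[RHS]/(Localization.add _ (Localization.opp _)) opp_cls add_cls.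
by apply/clsP; exists (one_denom p); rewrite /=; ring.
Qed.

Lemma to_loc_eq0 v : to_loc v = 0 <-> torsion p v.
Proof.
have -> : 0 = to_loc 0 by [].
split=> [/clsP[u /= E]|[s [sp sv]]].
  by exists (val u); split; [exact: valP u | move: E; rewrite !mulr1 subr0].
by apply/clsP; exists (exist (fun s => s \notin p) s sp) => /=; rewrite !mulr1 subr0.
Qed.

Lemma to_loc_inv s : s \notin p -> exists y, y * to_loc s = 1.
Proof.
move=> sp; exists (cls (1, exist (fun s => s \notin p) s sp)).
rewrite /to_loc -[LHS]/(Localization.mul _ _) mul_cls; apply/clsP; exists (one_denom p).
by rewrite /=; ring.
Qed.

Lemma to_loc_frac (x : L) : exists a t, t \notin p /\ to_loc t * x = to_loc a.
Proof.
rewrite -(cls_repr x); case: (repr x) => a t; exists a, (val t); split; first exact: valP t.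
rewrite /to_loc -[LHS]/(Localization.mul _ _) mul_cls; apply/clsP; exists (one_denom p).
by rewrite /=; ring.
Qed.

Lemma in_max_loc (x : L) : in_max_ideal x ->
  exists a t, [/\ a \in p, t \notin p & to_loc t * x = to_loc a].
Proof.
move=> [m' _ xm]; have [a [t [tp E]]] := to_loc_frac x.
exists a, t; split=> //; apply: contrapT => /negP ap.
have [y ya] := to_loc_inv ap.
by have := idealr1 m'; rewrite -ya -E idealMr // idealMr.
Qed.

Definition contraction (J : L^o -> Prop) : R^o -> Prop := fun v => J (to_loc v).

Lemma contraction_unit J s v : submod J -> s \notin p ->
  contraction J (s * v) -> contraction J v.
Proof.
move=> subJ /to_loc_inv[y ys]; rewrite /contraction to_locM => /(submodZ subJ y).
by rewrite [_ *: _]mulrA ys mul1r.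
Qed.

(** [x] and the image of [a] differ by the unit [to_loc t], so they generate the same ideal over
    [J]. *)
Lemma contraction_adjoin J (x : L) a t : submod J -> t \notin p -> to_loc t * x = to_loc a ->
  contraction (adjoin J x) = sat_adjoin p (contraction J) a.
Proof.
move=> subJ tp xE; apply/funext => v; apply/propext; split.
  move=> [b [w [Jb vE]]]; have [c [u [up wE]]] := to_loc_frac w.
  exists (t * u); split; first exact: prime_notin_mul.
  exists (t * u * v - a * c), c; split; last by rewrite subrK.
  rewrite /contraction to_locB !to_locM vE -xE -wE.
  have -> : to_loc t * to_loc u * (b + x *: w) - to_loc t * x * (to_loc u * w) =
    (to_loc t * to_loc u) *: b by rewrite -[x *: w]/(x * w) -[RHS]/(_ * b); ring.
  exact: submodZ.
move=> [s [sp [b [w [Jb sE]]]]]; have [y ys] := to_loc_inv sp.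
exists (y * to_loc b), (y * (to_loc t * to_loc w)); split; first exact: (submodZ subJ).
have -> : to_loc v = y * to_loc (s * v) by rewrite to_locM mulrA ys mul1r.
have -> : to_loc (s * v) = to_loc b + to_loc a * to_loc w.
  have -> : b = s * v - a * w by rewrite sE addrK.
  by rewrite to_locB !to_locM subrK.
by rewrite -xE -[x *: _]/(x * _); ring.
Qed.

Lemma contraction_loc_regular (J : L^o -> Prop) (xs : seq L) :
    submod J -> (forall x, x \in xs -> in_max_ideal x) -> regular_mod J xs ->
  exists ys, [/\ size ys = size xs, all [in p] ys & loc_regular p (contraction J) ys].
Proof.
elim: xs J => [|x xs IH] J subJ xsm; first by exists [::].
move=> [regx regxs]; have [a [t [ap tp xE]]] := in_max_loc (xsm x (mem_head _ _)).
have [y ym|ys [szys ysp regys]] := IH _ (submod_adjoin x subJ) _ regxs.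
  by apply: xsm; rewrite inE ym orbT.
exists (a :: ys); split=> [||] /=; rewrite ?szys ?ap //.
rewrite -(contraction_adjoin subJ tp xE); split=> // v.
rewrite /contraction to_locM -xE => h; apply: (contraction_unit subJ tp).
by apply: regx; rewrite to_locM [_ *: _]mulrCA mulrA.
Qed.

Lemma localization_regular (xs : seq L) :
    (forall x, x \in xs -> in_max_ideal x) -> regular_sequence L^o xs ->
  exists ys, [/\ size ys = size xs, all [in p] ys & loc_regular p (torsion p) ys].
Proof.
move=> xsm [/regular_sequence_mod regxs _].
have := contraction_loc_regular (submod_zero L^o) xsm regxs.
suff -> : contraction (fun v : L^o => v = 0) = torsion p by [].
by apply/funext => v; apply/propext; apply: to_loc_eq0.
Qed.

(** The image of [x] is nonzero and killed by [p], so no element of the maximal ideal is regular. *)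
Lemma depth_localization_associated (x : R) :
  (forall a, a \in p <-> a * x = 0) -> depth_ring L = 0%:E%E.
Proof.
move=> xP; rewrite /depth_ring /depth.
rewrite (_ : [set s | _] = [set [::]])%classic ?image_set1 ?supremum1 //.
apply/seteqP; split=> [[|y ys] [ysm]|_ ->] //=.
  move=> /localization_regular-/(_ ysm)[[|a zs] [//= _ /andP[ap _] [rega _]]].
  have [|s [sp sx]] := rega x; last by case/negP: sp; apply/xP.
  by exists 1; rewrite idealr1 mul1r; split=> //; apply/xP.
split=> //; split=> //; exists (quot_pi _ (1 : L^o)); apply/eqP => /quot_mod_eq0/seq_mulP /=.
exact/eqP/oner_neq0.
Qed.

End LocalizationRegular.

(** * Krull dimension *)

Section QuotientPrimes.
Variables (R : comNzRingType) (I : idealr R).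

Definition quot_map (x : R) : {ideal_quot I} := \pi_{ideal_quot I}%qT x.

Lemma quot_mapP x y : quot_map x = quot_map y <-> x - y \in I.
Proof. by rewrite Quotient.idealrBE; split=> /eqP. Qed.

Lemma quot_mapD x y : quot_map (x + y) = quot_map x + quot_map y.
Proof. exact: Quotient.pi_add. Qed.

Lemma quot_mapM x y : quot_map (x * y) = quot_map x * quot_map y.
Proof. exact: Quotient.pi_mul. Qed.

Lemma quot_map0 : quot_map 0 = 0.
Proof. by apply: (addrI (quot_map 0)); rewrite -quot_mapD !addr0. Qed.

Lemma quot_map1 : quot_map 1 = 1.
Proof. by rewrite /quot_map piE. Qed.

Lemma quot_mapK y : exists x, quot_map x = y.
Proof. by exists (repr y); apply: reprK. Qed.

Lemma comap_prime (q : prime_idealr {ideal_quot I}) :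
  exists p : prime_idealr R, forall x, x \in p <-> quot_map x \in q.
Proof.
pose J (x : R^o) : Prop := quot_map x \in q.
have subJ : submod J.
  split=> [|a x y Jx Jy]; first by rewrite /J quot_map0 idealr0.
  by rewrite /J quot_mapD quot_mapM rpredD // idealMr.
have J1 : ~ J 1 by rewrite /J quot_map1 idealr1.
have J_prime x y : J (x * y) -> J x \/ J y.
  by rewrite /J quot_mapM prime_idealrM => /orP.
by exists (mk_prime subJ J1 J_prime) => x; apply: mk_primeE.
Qed.

Lemma image_prime (p : prime_idealr R) : (forall x, x \in I -> x \in p) ->
  exists q : prime_idealr {ideal_quot I}, forall x, x \in p <-> quot_map x \in q.
Proof.
move=> Ip; pose J (y : {ideal_quot I}^o) : Prop := exists x, x \in p /\ quot_map x = y.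
have JE x : J (quot_map x) <-> x \in p.
  split=> [[y [yp /quot_mapP/Ip yx]]|xp]; last by exists x.
  by rewrite -(subKr y x) rpredB.
have subJ : submod J.
  split=> [|a _ _ [x [xp <-]] [y [yp <-]]].
    by exists 0; rewrite idealr0 quot_map0.
  have [b <-] := quot_mapK a; exists (b * x + y).
  by rewrite rpredD ?idealMr // quot_mapD quot_mapM.
have J1 : ~ J 1 by rewrite -quot_map1 JE idealr1.
have J_prime x y : J (x * y) -> J x \/ J y.
  have [[a <-] [b <-]] := (quot_mapK x, quot_mapK y).
  by rewrite -quot_mapM !JE prime_idealrM => /orP.
by exists (mk_prime subJ J1 J_prime) => x; rewrite -JE; split=> /mk_primeE.
Qed.

End QuotientPrimes.

Section KrullDimension.
Variable R : comNzRingType.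
Local Open Scope classical_set_scope.

(** Primes of [R / I] are treated as primes of [R] containing [I], so that the dimensions of
    different quotients are compared inside [R]. *)
Definition prime_chain (I : R -> Prop) (n : nat) : Prop :=
  exists p : 'I_n.+1 -> prime_idealr R, (forall i x, I x -> x \in p i) /\
    forall i j : 'I_n.+1, (i < j)%N -> {subset p i <= p j} /\ ~ {subset p j <= p i}.

Definition chain_dim (I : R -> Prop) : \bar int :=
  supremum -oo%E [set n%:Z%:E%E | n in prime_chain I].

Lemma prime_chain_sub (I J : R -> Prop) n :
  (forall x, J x -> I x) -> prime_chain I n -> prime_chain J n.
Proof. by move=> JI [p [Ip pP]]; exists p; split=> // i x /JI; apply: Ip. Qed.

Lemma krull_dimE : krull_dim R = chain_dim (fun x => x = 0).
Proof.
congr (supremum _ _); apply/seteqP; split=> _ [n [p pP] <-]; exists n => //.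
  by exists p; split=> // i x ->; apply: idealr0.
by exists p; case: pP.
Qed.

Lemma krull_dim_quot (I : idealr R) : krull_dim {ideal_quot I} = chain_dim (fun x => x \in I).
Proof.
congr (supremum _ _); apply/seteqP; split=> _ [n [p pP] <-]; exists n => //.
  have /choice[q qP] := fun i => comap_prime (p i).
  exists q; split=> [i x xI|i j ij].
    by apply/qP; rewrite (_ : quot_map I x = 0) ?idealr0 // -quot_map0; apply/quot_mapP; rewrite subr0.
  have [sub nsub] := pP i j ij; split=> [x /qP/sub/qP //|ji].
  by apply: nsub => y; have [x <-] := quot_mapK y => /qP/ji/qP.
have [Ip chain] := pP.
have /choice[q qP] := fun i => image_prime (Ip i).
exists q => i j ij; have [sub nsub] := chain i j ij; split=> [y|ji].
  by have [x <-] := quot_mapK y => /qP/sub/qP.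
by apply: nsub => x /qP/ji/qP.
Qed.

Lemma chain_dim_ge (I : R -> Prop) n : prime_chain I n -> (n%:Z%:E <= chain_dim I)%E.
Proof. by move=> chain; apply: le_supremum; exists n. Qed.

Lemma chain_dim_sub (I J : R -> Prop) (p : prime_idealr R) :
  (forall x, I x -> x \in p) -> (forall x, J x -> I x) -> (chain_dim I <= chain_dim J)%E.
Proof.
move=> Ip JI; apply: supremum_le => [|_ [n chain <-]].
  exists 0%:E%E, 0%N => //; exists (fun=> p); split=> // i j.
  by rewrite !ord1.
by apply: chain_dim_ge; apply: prime_chain_sub chain.
Qed.

Lemma prime_chain_rcons n (p : nat -> prime_idealr R) (q : prime_idealr R) :
    (forall i j, (i < j <= n)%N -> {subset p i <= p j} /\ ~ {subset p j <= p i}) ->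
    {subset p n <= q} -> ~ {subset q <= p n} ->
  exists p' : nat -> prime_idealr R, p' n.+1 = q /\
    forall i j, (i < j <= n.+1)%N -> {subset p' i <= p' j} /\ ~ {subset p' j <= p' i}.
Proof.
move=> chain pq qp; exists (fun i => if (i <= n)%N then p i else q); rewrite ltnn; split=> // i j.
case/andP=> ij; rewrite leq_eqVlt => /predU1P[jn|jn]; last first.
  have -> : (i <= n)%N by lia.
  by rewrite -ltnS jn; apply: chain; rewrite ij.
rewrite jn ltnn; have i_n : (i <= n)%N by lia.
rewrite i_n; move: i_n; rewrite leq_eqVlt => /predU1P[->//|lt].
have [|sub nsub] := chain i n; first by rewrite lt leqnn.
by split=> [x /sub/pq //|qi]; apply: nsub => x /pq/qi.
Qed.

Hypothesis noethR : noetherian R.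

(** The last element [x] is regular modulo the ideal of the others, so a prime below [q] contains
    the others and avoids [x]; the induction continues from that prime. *)
Lemma regular_prime_chain (s : seq R) (q : prime_idealr R) :
    all [in q] s -> regular_mod (fun v : R^o => v = 0) s ->
  exists p : nat -> prime_idealr R, p (size s) = q /\
    forall i j, (i < j <= size s)%N -> {subset p i <= p j} /\ ~ {subset p j <= p i}.
Proof.
elim/last_ind: s q => [|s x IH] q; first by exists (fun=> q); split=> // i [|j]; rewrite ?andbF.
rewrite all_rcons size_rcons => /andP[xq sq] /regular_modP regs.
pose I : R^o -> Prop := foldl (@adjoin R R^o) (fun v => v = 0) s.
have IE v : I v <-> exists c : 'I_(size s) -> R^o, v = \sum_(i < size s) s`_i *: c i.
  rewrite /I foldl_adjoin; split=> [[_ [c [-> ->]]]|[c ->]].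
    by exists c; rewrite add0r.
  by exists 0, c; rewrite add0r.
have subI : submod I.
  rewrite /I; move: (submod_zero R^o) {regs sq IH I IE}; move: (fun v : R^o => v = 0).
  by elim: s => //= y s IH B subB; apply/IH/submod_adjoin.
have Iq v : I v -> v \in q.
  move=> /IE[c ->]; apply: rpred_sum => i _.
  by rewrite [_ *: _]mulrC idealMr // (allP sq) ?mem_nth.
have Ix v : I (x * v) -> I v.
  have := regs (size s) _ v; rewrite size_rcons nth_rcons ltnn eqxx -cats1 take_size_cat //.
  exact.
have [p [pq Ip xp]] := exists_prime_below noethR subI Iq Ix.
have [||c [cs chain]] := IH p.
- apply/allP => y ys; apply: Ip; apply/IE.
  have lt : (index y s < size s)%N by rewrite index_mem.
  exists (fun i => (i == Ordinal lt)%:R).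
  rewrite (bigD1 (Ordinal lt)) //= eqxx nth_index // [_ *: 1]mulr1 big1 ?addr0 // => i /negPf ->.
  exact: scaler0.
- apply/regular_modP => i lt v; have := regs i _ v; rewrite size_rcons nth_rcons lt -cats1.
  by rewrite takel_cat ?(ltnW lt) //; apply; apply: ltnW.
apply: prime_chain_rcons chain _ _; rewrite cs //.
by move=> qp; move: xp; rewrite qp.
Qed.

Lemma regular_chain (m : prime_idealr R) (s : seq R) :
  all [in m] s -> regular_mod (fun v : R^o => v = 0) s -> prime_chain (fun x => x = 0) (size s).
Proof.
move=> sm /(regular_prime_chain sm)[p [_ chain]].
exists (fun i => p i); split=> [i _ ->|i j ij]; first exact: idealr0.
by apply: chain; rewrite ij -ltnS ltn_ord.
Qed.

End KrullDimension.

(** * The ring as a module over itself *)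

Section RingAsModule.
Variable R : comNzRingType.

Lemma free_module_fg_projective n :
  finitely_generated {ffun 'I_n -> R^o} /\ projective {ffun 'I_n -> R^o}.
Proof.
pose b (i : 'I_n) : {ffun 'I_n -> R^o} := [ffun j => (i == j)%:R].
have bE (c : {ffun 'I_n -> R^o}) : c = \sum_i c i *: b i.
  apply/ffunP => j; rewrite sum_ffunE (bigD1 j) //= !ffunE eqxx [_ *: 1]mulr1.
  by rewrite big1 ?addr0 // => i /negPf ij; rewrite !ffunE ij scaler0.
split; first by exists n, b => c; exists c; apply: bE.
move=> A B g f g_onto; have /choice[a aP] := fun i => g_onto (f (b i)).
have h_lin : linear (fun c : {ffun 'I_n -> R^o} => \sum_i c i *: a i).
  move=> u c d; rewrite scaler_sumr -big_split; apply: eq_bigr => i _.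
  by rewrite !ffunE scalerDl scalerA.
exists (mk_linear h_lin) => c /=; rewrite [in RHS](bE c) !linear_sum.
by apply: eq_bigr => i _; rewrite !linearZ_LR aP.
Qed.

Lemma homology_zero_diff (X : complex R) i : (forall i j x, cdiff X i j x = 0) ->
  isomorphic (homology X i) (X i).
Proof.
move=> d0; pose S := boundary_pred (cdiff X (i + 1) i) (g := cdiff X i (i - 1)).
have reprE k : val (quot_repr (quot_pi S k)) = val k.
  have /quot_piP/asboolP[u uE] := quot_reprK (quot_pi S k).
  by move/eqP: uE; rewrite d0 raddfB eq_sym subr_eq0 => /eqP.
have f_lin : linear (fun y : homology X i => val (quot_repr y)).
  move=> a y z; rewrite -(quot_reprK y) -(quot_reprK z) -[_ *: _]quot_pi_scale -quot_piD.
  by rewrite !reprE raddfD.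
have kerX x : x \in ker_pred (cdiff X i (i - 1)) by rewrite unfold_in d0.
exists (mk_linear f_lin).
exists (fun x => quot_pi S (exist (fun x => x \in ker_pred (cdiff X i (i - 1))) x (kerX x))).
  move=> y /=; rewrite -[RHS]quot_reprK; congr (quot_pi S _); exact: val_inj.
by move=> x; rewrite /= reprE.
Qed.

Lemma isomorphic_trans (U V W : lmodType R) :
  isomorphic U V -> isomorphic V W -> isomorphic U W.
Proof. by move=> [f bf] [g bg]; exists (g \o f); apply: bij_comp. Qed.

(** R in degree 0 and zero elsewhere, written as a power of R so that [i == 0] also serves as the
    exponent required by a quasi-projective resolution. *)
Definition unit_obj (i : int) : lmodType R := {ffun 'I_(i == 0) -> R^o}.

Definition unit_complex : complex R :=
  @Complex R unit_obj (fun _ _ => \0) (fun _ _ _ _ => erefl) (fun _ _ _ _ => erefl).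

Lemma unit_homology i : isomorphic (homology unit_complex i) {ffun 'I_(i == 0) -> R^o}.
Proof. exact: homology_zero_diff. Qed.

Lemma isomorphic_nonzero (U V : lmodType R) : isomorphic U V -> nonzero_mod U -> nonzero_mod V.
Proof.
move=> [f bf] [x x0]; exists (f x); apply: contra x0 => /eqP fx.
by apply/eqP/(bij_inj bf); rewrite fx linear0.
Qed.

Lemma unit_obj_nonzero i : nonzero_mod (unit_obj i) <-> i = 0.
Proof.
split=> [|->].
  by rewrite /unit_obj; case: eqP => // _ [x /eqP]; case; apply/ffunP; case.
exists [ffun=> 1]; apply/eqP => /ffunP/(_ ord0); rewrite !ffunE.
exact/eqP/oner_neq0.
Qed.

Local Open Scope classical_set_scope.

Lemma unit_csup : [set i%:E%E | i in [set i | nonzero_mod (unit_complex i)]] = [set 0%:E%E].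
Proof.
apply/seteqP; split=> [_ [i /unit_obj_nonzero -> <-] //|_ ->].
by exists 0 => //; apply/unit_obj_nonzero.
Qed.

Lemma qpd_ring : (qpd R^o < +oo)%E.
Proof.
have csupE : csup unit_complex = 0%:E%E by rewrite /csup unit_csup supremum1.
have cinfE : cinf unit_complex = 0%:E%E.
  by rewrite /cinf unit_csup; apply: infimumE; [rewrite infimums1 | exists 0%:E%E].
(* This excludes the value -oo of [hsup], for which the difference would be +oo. *)
have hsup_ge : (0%:E <= hsup unit_complex)%E.
  apply: le_supremum; exists 0 => //.
  have [f [g fK gK]] := unit_homology 0; have [x x0] := (unit_obj_nonzero 0).2 erefl.
  exists (g x); apply: contra x0 => /eqP gx.
  by rewrite -(gK x) gx linear0.
apply: (@le_lt_trans _ _ (csup unit_complex - hsup unit_complex)%E).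
  apply: ge_infimum; exists unit_complex; split=> //.
    split; first by rewrite /bounded_below cinfE.
      by move=> i; apply: free_module_fg_projective.
    exists (fun i => (i == 0) : nat); split=> [i _|]; first exact: unit_homology.
    by exists 0 => //; rewrite cinfE.
  by rewrite /bounded csupE cinfE.
by rewrite csupE; case: (hsup _) hsup_ge => [x _||] //; rewrite -EFinB ltry.
Qed.

Lemma projective_resolution_ring : projective_resolution unit_complex R^o.
Proof.
split=> [i|i i0 /unit_obj_nonzero iE|i i0|].
- by case: (free_module_fg_projective (i == 0)).
- by rewrite iE in i0.
- by move/(isomorphic_nonzero (unit_homology i))/unit_obj_nonzero => iE; rewrite iE in i0.
apply: (isomorphic_trans (unit_homology 0)).
have f_lin : linear (fun c : {ffun 'I_1 -> R^o} => c ord0) by move=> a c d; rewrite !ffunE.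
exists (mk_linear f_lin), (fun x => [ffun=> x]) => [c|x] /=; last by rewrite ffunE.
by apply/ffunP => i; rewrite ffunE; congr (c _); apply/val_inj; case: i => [[]].
Qed.

End RingAsModule.

Section ResolutionAugmentation.
Variables (R : comNzRingType) (P : complex R) (M : lmodType R).

Lemma resolution_augmentation : projective_resolution P M ->
  exists pi : {linear P 0 -> M}, (forall x, exists y, pi y = x) /\
    forall y, pi y = 0 <-> exists z, cdiff P 1 0 z = y.
Proof.
move=> [_ neg0 _ H0]; have [g [g_onto gP]] := homology_iso (i := 0) (a := 1) (b := -1) erefl erefl H0.
have kerP x : x \in ker_pred (cdiff P 0 (-1)).
  by rewrite unfold_in; apply/eqP/zero_mod_eq0/neg0.
pose k x : kernel (cdiff P 0 (-1)) := exist (fun x => x \in ker_pred (cdiff P 0 (-1))) x (kerP x).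
have k_lin : linear k by move=> a x y; apply: val_inj.
exists (g \o mk_linear k_lin); split=> [x|y] /=; last exact: gP.
have [l gl] := g_onto x; exists (val l); rewrite -gl; congr (g _).
exact: val_inj.
Qed.

End ResolutionAugmentation.

(** * Cohen-Macaulay criteria *)

Section RegularLength.
Variable R : comNzRingType.
Local Open Scope classical_set_scope.

Definition regular_length (M : lmodType R) (n : nat) : Prop :=
  exists s : seq R, [/\ size s = n, forall x, x \in s -> in_max_ideal x & regular_sequence M s].

Lemma depthE (M : lmodType R) :
  depth M = supremum -oo%E [set n%:Z%:E%E | n in regular_length M].
Proof.
congr (supremum _ _); apply/seteqP; split=> z [].
  by move=> s [sm regs] <-; exists (size s) => //; exists s.
by move=> n [s [<- sm regs]] <-; exists s.
Qed.

Lemma regular_length0 (M : lmodType R) : nonzero_mod M -> regular_length M !=set0.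
Proof.
move=> [x x0]; exists 0%N, [::]; split=> //; split=> //; exists (quot_pi _ x).
apply: contra x0 => /eqP/quot_mod_eq0/seq_mulP /= ->.
exact: eqxx.
Qed.

Lemma depth_ge n : regular_length R^o n -> (n%:Z%:E <= depth_ring R)%E.
Proof. by move=> regn; rewrite /depth_ring depthE; apply: le_supremum; exists n. Qed.

Lemma nonzero_ring : nonzero_mod R^o.
Proof. by exists 1; apply: oner_neq0. Qed.

Lemma dim_modE (M : lmodType R) : nonzero_mod M ->
  dim_mod M = chain_dim (fun a => forall x : M, a *: x = 0).
Proof.
move=> nzM; rewrite /dim_mod; case: pselect => // M0; rewrite krull_dim_quot.
by congr (chain_dim _); apply/funext => a; apply/propext; split=> /asboolP.
Qed.

Lemma dim_ringE : dim_mod R^o = krull_dim R.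
Proof.
rewrite (dim_modE nonzero_ring) krull_dimE; congr (chain_dim _).
apply/funext => a; apply/propext; split=> [/(_ 1)|-> x]; last exact: scale0r.
by rewrite [_ *: _]mulr1.
Qed.

End RegularLength.

Section LocalDepth.
Variables (R : comNzRingType) (m : prime_idealr R).
Hypotheses (noethR : noetherian R) (unit_m : forall x, x \notin m -> exists y, y * x = 1).
Hypothesis in_maxE : forall x, in_max_ideal x <-> x \in m.
Local Open Scope classical_set_scope.

Lemma regular_lengthE (M : lmodType R) n :
  regular_length M n <-> exists s, [/\ size s = n, all [in m] s & regular_sequence M s].
Proof.
split=> -[s [sn sm regs]]; exists s; split=> //; first by apply/allP => x /sm/in_maxE.
by move=> x /(allP sm)/in_maxE.
Qed.

Lemma depth_le_dim : (depth_ring R <= krull_dim R)%E.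
Proof.
rewrite /depth_ring depthE krull_dimE; apply: supremum_le.
  by have [n regn] := regular_length0 (nonzero_ring R); exists n%:Z%:E%E, n.
move=> _ [n /regular_lengthE[s [<- sm [/regular_sequence_mod regs _]]] <-].
exact: chain_dim_ge (regular_chain noethR sm regs).
Qed.

Lemma ann_sub_max (M : lmodType R) : nonzero_mod M ->
  forall a, (forall x : M, a *: x = 0) -> a \in m.
Proof.
move=> [x x0] a ax; apply: contraNT x0 => /unit_m[y ya].
by rewrite -[x]scale1r -ya -scalerA ax scaler0.
Qed.

Lemma dim_mod_ge0 (M : lmodType R) : nonzero_mod M -> (0 <= dim_mod M)%E.
Proof.
move=> nzM; rewrite (dim_modE nzM); apply: (chain_dim_ge (n := 0)).
exists (fun=> m); split=> [_ a|i j]; first exact: ann_sub_max.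
by rewrite !ord1.
Qed.

Lemma depth_finite : exists n, [/\ regular_length R^o n, depth_ring R = n%:Z%:E%E &
  forall k, regular_length R^o k -> (k <= n)%N].
Proof.
have [t nt] := acyclic_bounded m noethR.
have [[_ /(_ t)[k [/regular_lengthE[s [<- sm [/regular_sequence_mod regs _]]] tk]]]|] :=
  supremum_nat (regular_length0 (nonzero_ring R)); last by rewrite /depth_ring depthE.
by case: nt; apply: acyclic_leq tk _; apply: regular_acyclic (submod_zero _) sm regs.
Qed.

Lemma exists_prime_of_max_dim : cohen_macaulay R ->
  exists (p : prime_idealr R) (x : R), (forall a, a \in p <-> a * x = 0) /\
    krull_dim {ideal_quot p} = krull_dim R.
Proof.
rewrite /cohen_macaulay /cohen_macaulay_mod dim_ringE => CM.
(* Since dim R equals the finite depth, a longest chain of primes exists. *)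
have [n [_ depthn _]] := depth_finite.
have dimn : chain_dim (fun x : R => x = 0) = n%:Z%:E%E by rewrite -krull_dimE -CM.
have [|[]|[k [[p [_ chain]] dimk maxk]]] := @supremum_nat (prime_chain (fun x : R => x = 0)).
- by exists 0%N, (fun=> m); split=> [i _ ->|i j]; [exact: idealr0 | rewrite !ord1].
- by rewrite -/(chain_dim _) dimn.
have p0_sub i x : x \in p ord0 -> x \in p i.
  have [->//|i0] := eqVneq i ord0.
  by have [|sub _] := chain ord0 i; [rewrite lt0n | apply: sub].
have [|x xP] := @minimal_prime_associated R noethR (p ord0).
  move=> q qp x xp; apply: contrapT => xq.
  have /maxk : prime_chain (fun x : R => x = 0) k.+1; last by rewrite ltnn.
  exists (fun i => if unlift ord0 i is Some j then p j else q).
  split=> [i _ ->|i j]; first by case: unlift => [l|]; apply: idealr0.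
  case: (unliftP ord0 i) => [i' ->|->]; case: (unliftP ord0 j) => [j' ->|->] //=.
  - by rewrite /bump /= !add1n ltnS; apply: chain.
  - by move=> _; split=> [y /qp/p0_sub|sub] //; apply: xq; apply/sub/p0_sub.
exists (p ord0), x; split=> //; apply/eqP; rewrite eq_le krull_dim_quot krull_dimE; apply/andP; split.
  by apply: (@chain_dim_sub _ _ _ (p ord0)) => // _ ->; apply: idealr0.
rewrite [leLHS]dimk; apply: chain_dim_ge; exists p; split=> // i y; exact: p0_sub.
Qed.

Lemma proj_resP (M : lmodType R) :
  (exists P, projective_resolution P M) -> projective_resolution (proj_res M) M.
Proof. by rewrite /proj_res; case: pselect => // ex _; exact: svalP (cid ex). Qed.

Lemma ext0_ring : nonzero_mod (Ext 0 R^o R^o).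
Proof.
have res : projective_resolution (proj_res R^o) R^o.
  by apply: proj_resP; exists (unit_complex R); apply: projective_resolution_ring.
have [pi [pi_onto pi0]] := resolution_augmentation res.
apply: contrapT => /hom_homology_zero-/(_ 0 1 (-1) erefl erefl erefl pi)[x|psi psiP].
  by apply/pi0; exists x.
have [_ neg0 _ _] := res; have [y piy] := pi_onto 1.
have := oner_neq0 R; rewrite -piy psiP (_ : cdiff _ _ _ _ = 0) ?linear0 ?eqxx //.
exact/zero_mod_eq0/neg0.
Qed.

Lemma grade_ring : grade R^o = 0%:E%E.
Proof.
have [E|[n [_ E nmin]]] := infimum_nat (fun n => nonzero_mod (Ext n R^o R^o)).
  have : (grade R^o <= 0%:E)%E by apply: ge_infimum; exists 0%N => //; apply: ext0_ring.
  by rewrite /grade E.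
by rewrite /grade E; have := nmin _ ext0_ring; case: n {E nmin}.
Qed.

Section Criteria.
Variable M : lmodType R.
Hypotheses (nzM : nonzero_mod M) (cmM : cohen_macaulay_mod M) (qpdM : (qpd M < +oo)%E).

Lemma cohen_macaulay_depth : (krull_dim R <= depth_ring R)%E -> cohen_macaulay R.
Proof.
move=> dim_le; rewrite /cohen_macaulay /cohen_macaulay_mod dim_ringE.
by apply/eqP; rewrite eq_le dim_le depth_le_dim.
Qed.

(** The depth of [R] bounds every [k + c], so the lengths of regular sequences on [M] are bounded
    and a longest one exists. *)
Lemma depth_attained (c : nat) :
    (forall k, regular_length M k -> regular_length R^o (k + c)) ->
  exists k, depth M = k%:Z%:E%E /\ regular_length R^o (k + c).
Proof.
move=> kc; have [n [_ _ nmax]] := depth_finite.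
have [[_ /(_ n.+1)[k [/kc/nmax kn nk]]]|[k [regk depthk _]]] := supremum_nat (regular_length0 nzM).
  by have := leq_trans (leq_trans nk (leq_addr c k)) kn; rewrite ltnn.
by exists k; rewrite depthE; split=> //; apply: kc.
Qed.

Lemma regular_length_grade (g k : nat) :
    nonzero_mod (Ext g M R^o) -> (forall i, (i < g)%N -> ~ nonzero_mod (Ext i M R^o)) ->
  regular_length M k -> regular_length R^o (k + g).
Proof.
move=> extg ext0 /regular_lengthE[s [<- sm [/regular_sequence_mod regs _]]].
apply/regular_lengthE; case: (posnP g) => [->|g0].
  by rewrite addn0; exact: (depth_bound noethR unit_m nzM qpdM sm regs).
have res := grade_projective_resolution g0 ext0 extg.
have [pi [pi_onto pi0]] := resolution_augmentation res; have [projP neg0 _ _] := res.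
apply: (depth_grade_bound noethR unit_m nzM qpdM sm regs (F := fun n => proj_res M n%:Z)
  (d := fun n => cdiff (proj_res M) n.+1 n) (pi := pi)) => //.
- by move=> n x; apply: cdiff_sq0.
- by move=> x; apply/pi0; exists x.
- by apply: proj_res_coboundary => // i x i0; apply/zero_mod_eq0/neg0.
Qed.

Lemma cohen_macaulay_grade :
  dim_mod M = (krull_dim R - grade M)%E -> cohen_macaulay R.
Proof.
move=> dimM; apply: cohen_macaulay_depth; have := dim_mod_ge0 nzM.
have [E|[g [extg E gmin]]] := infimum_nat (fun n => nonzero_mod (Ext n M R^o)).
  (* An infinite grade would make [dim_mod M] equal to -oo, but it is nonnegative. *)
  by rewrite dimM /grade E; case: (krull_dim R).
have ext0 i : (i < g)%N -> ~ nonzero_mod (Ext i M R^o).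
  by move=> ig /gmin; rewrite leqNgt ig.
have [k [depthk regk]] := depth_attained (fun k => regular_length_grade extg ext0).
move: dimM; rewrite -cmM depthk /grade E => dimM _; apply: le_trans (depth_ge regk).
case: (krull_dim R) dimM => [d|//|//]; rewrite -EFinB => -[dE].
rewrite lee_fin; lia.
Qed.

Lemma cohen_macaulay_prime (p : prime_idealr R) : associated_prime M p ->
  (krull_dim {ideal_quot p} + depth_ring (localization p))%E = krull_dim R ->
  cohen_macaulay R.
Proof.
move=> assp dimR; apply: cohen_macaulay_depth.
have bound k l : regular_length M k -> regular_length (localization p)^o l ->
    regular_length R^o (k + l).
  move=> /regular_lengthE[s [<- sm [/regular_sequence_mod regs _]]] [xs [<- xsm regxs]].
  have [ys [<- ysp regys]] := localization_regular xsm regxs.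
  exact/regular_lengthE/(depth_localization_bound noethR unit_m nzM qpdM sm regs assp ysp regys).
have [l [depthl regl]] : exists l, depth_ring (localization p) = l%:Z%:E%E /\
    regular_length (localization p)^o l.
  (* The same bound shows that the depth of the localization is finite: it cannot exceed that of
     [R]. *)
  have [n [_ _ nmax]] := depth_finite; have [k0 regk0] := regular_length0 nzM.
  have := supremum_nat (regular_length0 (nonzero_ring (localization p))).
  rewrite /depth_ring depthE => -[[_ /(_ n.+1)[l [regl nl]]]|[l [regl E _]]]; last by exists l.
  by have := nmax _ (bound _ _ regk0 regl); lia.
have [k [depthk regkl]] := depth_attained (fun k regk => bound k l regk regl).
(* It remains to see that dim R/p is at most depth M = dim M, which holds because [p] contains the
   annihilator of [M]. *)
apply: le_trans (depth_ge regkl); rewrite -dimR depthl PoszD EFinD leeD2r //.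
rewrite -depthk cmM (dim_modE nzM) krull_dim_quot; apply: (@chain_dim_sub _ _ _ p) => // a ax.
by have [x xP] := assp; apply/xP.
Qed.

End Criteria.

End LocalDepth.

Local Open Scope ereal_scope.

Theorem corollary5p11 (R : comNzRingType) :
  noetherian R -> local R ->
  (cohen_macaulay R <->
   exists M : lmodType R,
     [/\ nonzero_mod M, finitely_generated M & cohen_macaulay_mod M] /\
     qpd M < +oo /\ dim_mod M = krull_dim R - grade M) /\
  (cohen_macaulay R <->
   exists M : lmodType R,
     [/\ nonzero_mod M, finitely_generated M & cohen_macaulay_mod M] /\
     qpd M < +oo /\
     exists p : prime_idealr R, associated_prime M p /\
       krull_dim {ideal_quot p} + depth_ring (localization p) = krull_dim R).
Proof.
move=> noethR /(local_maximal_ideal noethR)[m [unit_m in_maxE]].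
have fgR : finitely_generated R^o.
  by exists 1%N, (fun=> 1%R) => x; exists (fun=> x); rewrite big_ord1 [_ *: _]mulr1.
split; split=> [CM|].
- exists R^o; split; [by split=> //; apply: nonzero_ring | split; first exact: qpd_ring].
  by rewrite dim_ringE grade_ring sube0.
- move=> [M [[nzM _ cmM] [qpdM dimM]]].
  exact: (cohen_macaulay_grade noethR unit_m in_maxE nzM cmM qpdM dimM).
- have [p [x [xP dimp]]] := exists_prime_of_max_dim noethR in_maxE CM.
  exists R^o; split; [by split=> //; apply: nonzero_ring | split; first exact: qpd_ring].
  exists p; split; first by exists x.
  by rewrite (depth_localization_associated xP) adde0.
- move=> [M [[nzM _ cmM] [qpdM [p [assp dimR]]]]].
  exact: (cohen_macaulay_prime noethR unit_m in_maxE nzM cmM qpdM assp dimR).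
Qed.
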